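(* Let $B$ be an invertible bounded linear operator on a complex Hilbert space $H\neq\{0\}$. The linear reduction factor $$M_B=\sup_{z\in H}\ \sup_{k\in\mathbb{N}}\ \frac{\|r_k^{B,z}\|}{\|r_{k-1}^{B,z}\|}$$ fulfills $$M_B=\inf_{\lambda\in\mathbb{C}}\|I-\lambda B\|=\inf_{\lambda\in\mathbb{C}}\|I-\lambda B^{-1}\|\le\sqrt{1-\nu_B\,\nu_{B^{-1}}}\le\sqrt{1-\frac{\nu_B^2}{\|B\|^2}} .$$ Furthermore, the following assertions are equivalent: (L1) the operator $B$ exhibits linear GMRES convergence with factor less than one, i.e., $\|r_k^{B,r_0}\|\le M_B\,\|r_{k-1}^{B,r_0}\|$ for all $k\in\mathbb{N}$ and all $r_0\in H$ with some $M_B<1$; (L2) $\nu_B>0$; (L3) $\nu_{B^{-1}}>0$. The following assertions are equivalent as well: (M1) the operator $B$ exhibits strictly monotone GMRES convergence, i.e., for every $k\in\mathbb{N}$ and every $r_0\in H$, $\|r_k^{B,r_0}\|<\|r_{k-1}^{B,r_0}\|$ or $\|r_{k-1}^{B,r_0}\|=0$; (M2) $0\notin\operatorname{Num}(B)$; (M3) $0\notin\operatorname{Num}(B^{-1})$. If $H$ is finite-dimensional or $B$ is self-adjoint, then (L1), (L2), (L3), (M1), (M2), and (M3) are equivalent.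
   Context: $(\cdot,\cdot)$ is the inner product of $H$ (linear in the first argument); $\|\cdot\|$ denotes both the norm of $H$ and the induced operator norm; $I$ is the identity; $\mathbb{N}=\{1,2,\dots\}$; invertible means having a bounded inverse on $H$. For a bounded linear operator $T$ on $H$, the numerical range is $\operatorname{Num}(T)=\{(Tz,z): z\in H,\ \|z\|=1\}\subset\mathbb{C}$, and $\nu_T=\inf_{\lambda\in\operatorname{Num}(T)}|\lambda|$. $\mathcal{P}_k$ is the space of complex polynomials of degree at most $k$. GMRES residuals: for a bounded linear operator $T$ on $H$, an initial residual $r_0\in H$ and $k=0,1,2,\dots$, let $\mathcal{K}_k(T,r_0)=\operatorname{span}\{r_0,Tr_0,\dots,T^{k-1}r_0\}$ (so $\mathcal{K}_0=\{0\}$). The $k$-th GMRES residual $r_k^{T,r_0}$ is the element of minimal norm in the affine space $r_0+T\mathcal{K}_k(T,r_0)$. Thus $r_0^{T,r_0}=r_0$ and $\|r_k^{T,r_0}\|=\min_{p\in\mathcal{P}_k,\,p(0)=1}\|p(T)r_0\|$. The number $M_B$ defined by the supremum is equivalently the best (smallest nonnegative) constant $M$ such that $\|r_k^{B,z}\|\le M\,\|r_{k-1}^{B,z}\|$ for all $k\in\mathbb{N}$ and all $z\in H$; accordingly, quotients $0/0$ of norms of residuals are interpreted as $0$. *)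

(* Defs.v *)
From HB Require Import structures.
From mathcomp Require Import all_boot all_order all_algebra.
From mathcomp Require Import all_classical all_reals all_analysis.
From mathcomp Require Export complex.

Set Implicit Arguments.
Unset Strict Implicit.
Unset Printing Implicit Defensive.

Import Order.TTheory GRing.Theory Num.Theory.
Import numFieldNormedType.Exports.

Local Open Scope classical_set_scope.
Local Open Scope ring_scope.

Section Gmres.
Variables (R : realType) (H : completeNormedModType R[i]).
Implicit Types (T : H -> H) (dot : H -> H -> R[i]) (z : H) (k : nat).

(* The norm of a normed R[i]-module takes values in R[i], where it is always
   real; sup and inf need it as an element of R. *)
Definition rnorm z : R := complex.Re `|z|.

Definition opnorm T : R := sup [set rnorm (T z) | z in [set z | rnorm z <= 1]].

Definition numrange dot T : set R[i] :=
  [set dot (T z) z | z in [set z | rnorm z = 1]].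

Definition nu dot T : R :=
  inf [set complex.Re `|l| | l in numrange dot T].

Definition selfadjoint dot T := forall x y, dot (T x) y = dot x (T y).

Definition lin_span n (e : 'I_n -> H) : set H :=
  [set \sum_(i < n) c i *: e i | c in [set: 'I_n -> R[i]]].

Definition finite_dimensional :=
  exists n (e : 'I_n -> H), lin_span e = [set: H].

Definition krylov T k (r0 : H) : set H := lin_span (fun i : 'I_k => iter i T r0).

Definition is_gmres_residual T k (r0 r : H) :=
  let A := [set r0 + T x | x in krylov T k r0] in
  A r /\ forall y, A y -> rnorm r <= rnorm y.

(* The affine space r0 + T K_k is finite-dimensional and the norm is strictly
   convex, so that there is exactly one minimizer for a linear T; the default
   value 0 of xget is then never used. *)
Definition gmres_residual T k (r0 : H) : H := xget 0 (is_gmres_residual T k r0).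

(* As x / 0 = 0 in R, the quotients 0 / 0 are 0. *)
Definition linear_reduction_factor T : R :=
  sup [set q | exists z k, (0 < k)%N /\
    q = rnorm (gmres_residual T k z) / rnorm (gmres_residual T k.-1 z)].

Definition linear_gmres_convergence T :=
  exists2 M : R, M < 1 & forall k r0, (0 < k)%N ->
    rnorm (gmres_residual T k r0) <= M * rnorm (gmres_residual T k.-1 r0).

Definition strictly_monotone_gmres_convergence T :=
  forall k r0, (0 < k)%N ->
    rnorm (gmres_residual T k r0) < rnorm (gmres_residual T k.-1 r0) \/
    rnorm (gmres_residual T k.-1 r0) = 0.

End Gmres.
Arguments finite_dimensional {R} H.

(* Main.v *)
Require Import Defs.
From HB Require Import structures.
From mathcomp Require Import all_boot all_order all_algebra.
From mathcomp Require Import all_classical all_reals all_analysis.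
From mathcomp Require Import ring lra.

(** Any GMRES step reduces the residual at least as much as a first step from
    the current residual [r], because the new affine space contains all the
    vectors [r - l *: B r] ([gmres_step]). Hence the linear reduction factor is
    the supremum over unit vectors [z] of the minimum over [l] of the norm of
    [z - l *: B z] ([reduction_factor_le], [reduction_factor_step]), and its
    equality with the infimum over [l] of the norms of the operators [I - l B]
    is a minimax theorem ([minimax], [reduction_factorE]).

    For the minimax theorem, let [A = I - l0 B] be an operator of minimal norm
    [N] in the pencil. As no direction [u] of the complex plane leads to a
    smaller norm, there is for each [u] a unit vector [z] almost attaining [N]
    such that the real part of [u^* * dot (A z) (B z)] is almost nonpositive
    ([minimizer_direction]). The values [dot (A z) (B z)] over such [z] form an
    approximately convex set: this is the argument of Toeplitz and Hausdorff
    ([toeplitz_hausdorff]), whose vectors are combinations with bounded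
    coefficients and therefore still almost attain [N]. If these values stayed
    away from [0], a step from one of almost minimal modulus towards one in the
    opposite half-plane would come closer to [0]. So some [z] almost attaining
    [N] has [A z] almost orthogonal to [B z], and then no multiple of [B z]
    reduces the norm of [A z] noticeably.

    The best reduction of [z] along [B z] is the sine of the angle between the
    two vectors, which is symmetric in them ([reducibleP]). Exchanging them
    exchanges [B] with its inverse, which gives the second equality. The bound
    by numerical ranges holds because the squared cosine of this angle is the
    product of the modulus of [dot (B z) z] over the squared norm of [z] and of
    the same modulus over the squared norm of [B z], and these factors are the
    moduli of values of the numerical ranges of [B] and of its inverse
    ([nu_mul_le]). The
    equivalences for linear convergence say that the cosine is bounded away
    from [0], those for strict monotonicity that it does not vanish.

    The two kinds of convergence agree as soon as a numerical range avoiding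
    [0] stays away from [0]. In finite dimension this is compactness
    ([finite_dimensional_nu]). For a self-adjoint operator, convexity of the
    numerical range makes the quadratic form of the operator definite, and a
    semidefinite form controls the norm of the operator ([selfadjoint_nu]). *)

Import Order.TTheory GRing.Theory Num.Theory.
Import numFieldNormedType.Exports.

Local Open Scope classical_set_scope.
Local Open Scope ring_scope.

Set Implicit Arguments.
Unset Strict Implicit.
Unset Printing Implicit Defensive.

Local Open Scope complex_scope.
(* The conjugation of [complex_scope] is convertible to the generic one, for
   which inner products are stated, but differs from it syntactically. *)
Local Notation "c ^*" := (Num.conj c) : complex_scope.

(** * Inner products and norms with real values *)

Section InnerProduct.
Variables (R : realType) (H : completeNormedModType R[i]).
Variable dot : {dot H for Num.conj}.
Hypothesis dotE : forall z : H, dot z z = `|z| ^+ 2.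
Implicit Types (x y z : H) (c d : R[i]) (a b t : R).

Lemma dotDl x y z : dot (x + y) z = dot x z + dot y z.
Proof. exact: linearDl. Qed.

Lemma dotDr x y z : dot z (x + y) = dot z x + dot z y.
Proof. exact: linearD. Qed.

Lemma dotNl x z : dot (- x) z = - dot x z.
Proof. exact: linearNl. Qed.

Lemma dotNr x z : dot z (- x) = - dot z x.
Proof. exact: linearN. Qed.

Lemma dotZl c x z : dot (c *: x) z = c * dot x z.
Proof. exact: linearZl_LR. Qed.

Lemma dotZr c x z : dot z (c *: x) = c^* * dot z x.
Proof. exact: linearZr_LR. Qed.

Lemma dotC x y : dot y x = (dot x y)^*.
Proof. by rewrite hermC expr0 mul1r. Qed.

Lemma dot0r x : dot x 0 = 0.
Proof. exact: linear0. Qed.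

Definition sqmod c : R := complex.Re c ^+ 2 + complex.Im c ^+ 2.

Lemma ler_sqr_nneg a b : 0 <= a -> a <= b -> a ^+ 2 <= b ^+ 2.
Proof. by move=> a0 ab; rewrite lerXn2r// nnegrE (le_trans a0). Qed.

Lemma sqmod_ge0 c : 0 <= sqmod c.
Proof. by rewrite addr_ge0 ?sqr_ge0. Qed.

Lemma sqmod0 : sqmod 0 = 0.
Proof. by rewrite /sqmod /= expr0n addr0. Qed.

Lemma sqmod_eq0 c : sqmod c = 0 -> c = 0.
Proof.
case: c => a b /eqP; rewrite /sqmod /= paddr_eq0 ?sqr_ge0// !sqrf_eq0.
by case/andP=> /eqP-> /eqP->.
Qed.

Lemma sqmodM c d : sqmod (c * d) = sqmod c * sqmod d.
Proof. by case: c => ? ?; case: d => ? ?; rewrite /sqmod /=; ring. Qed.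

Lemma sqmodJ c : sqmod c^* = sqmod c.
Proof. by case: c => ? ?; rewrite /sqmod /= sqrrN. Qed.

Lemma mul_conj c : c^* * c = (sqmod c)%:C.
Proof.
by case: c => a b; apply/eqP; rewrite eq_complex /sqmod /=;
  apply/andP; split; apply/eqP; ring.
Qed.

Lemma conj_real a : (a%:C : R[i])^* = a%:C.
Proof. by apply/eqP; rewrite eq_complex /= oppr0 !eqxx. Qed.

Lemma conj_realM a c : (a%:C * c)^* = a%:C * c^*.
Proof.
by case: c => b d; apply/eqP; rewrite eq_complex /=;
  apply/andP; split; apply/eqP; ring.
Qed.

Lemma sqmod_real a : sqmod a%:C = a ^+ 2.
Proof. by rewrite /sqmod /= expr0n addr0. Qed.

Lemma Re_norm c : complex.Re `|c| = Num.sqrt (sqmod c).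
Proof. by rewrite normc_def. Qed.

Lemma Re_norm_sqr c : complex.Re `|c| ^+ 2 = sqmod c.
Proof. by rewrite Re_norm sqr_sqrtr ?sqmod_ge0. Qed.

Lemma rnorm_ge0 z : 0 <= rnorm z.
Proof. by have := normr_ge0 z; rewrite /rnorm lecE => /andP[]. Qed.

Lemma rnormE z : (rnorm z)%:C = `|z|.
Proof. by rewrite /rnorm RRe_real// normr_real. Qed.

Lemma rnorm0 : rnorm (0 : H) = 0.
Proof. by rewrite /rnorm normr0. Qed.

Lemma rnorm_eq0 z : rnorm z = 0 -> z = 0.
Proof.
by move=> z0; apply/eqP; rewrite -normr_eq0 -rnormE z0.
Qed.

Lemma rnorm_gt0 z : z != 0 -> 0 < rnorm z.
Proof.
move=> z0; rewrite lt_neqAle rnorm_ge0 andbT eq_sym.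
by apply: contra z0 => /eqP/rnorm_eq0 ->.
Qed.

Lemma rnorm_eq0_or_gt0 z : rnorm z = 0 \/ 0 < rnorm z.
Proof.
by have [->|/rnorm_gt0 z0] := eqVneq z 0; [left; exact: rnorm0 | right].
Qed.

Lemma rnormZ_sqr c z : rnorm (c *: z) ^+ 2 = sqmod c * rnorm z ^+ 2.
Proof.
by rewrite /rnorm normrZ -!rnormE -Re_norm_sqr -exprMn normc_def /= mulr0 subr0.
Qed.

Lemma rnormZ c z : rnorm (c *: z) = Num.sqrt (sqmod c) * rnorm z.
Proof.
apply/eqP; rewrite -(@eqrXn2 _ 2) ?mulr_ge0 ?rnorm_ge0 ?sqrtr_ge0//.
by rewrite rnormZ_sqr exprMn sqr_sqrtr ?sqmod_ge0.
Qed.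

Lemma rnormZr a z : rnorm (a%:C *: z) = `|a| * rnorm z.
Proof.
apply/eqP; rewrite -(@eqrXn2 _ 2) ?mulr_ge0 ?rnorm_ge0//.
by rewrite rnormZ_sqr sqmod_real exprMn real_normK ?num_real.
Qed.

Lemma rnormN z : rnorm (- z) = rnorm z.
Proof. by rewrite /rnorm normrN. Qed.

Lemma rnormD x y : rnorm (x + y) <= rnorm x + rnorm y.
Proof.
by have := ler_normD x y; rewrite -!rnormE -rmorphD lecR.
Qed.

Lemma rnormB x y : rnorm (x - y) <= rnorm x + rnorm y.
Proof. by rewrite -[rnorm y]rnormN rnormD. Qed.

Lemma Re_dotzz z : complex.Re (dot z z) = rnorm z ^+ 2.
Proof. by rewrite dotE -rnormE -rmorphXn. Qed.

Lemma Re_dotC x y : complex.Re (dot y x) = complex.Re (dot x y).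
Proof. by rewrite dotC; case: (dot x y). Qed.

Lemma Im_dotC x y : complex.Im (dot y x) = - complex.Im (dot x y).
Proof. by rewrite dotC; case: (dot x y). Qed.

Lemma rnormD_sqr x y :
  rnorm (x + y) ^+ 2 = rnorm x ^+ 2 + 2 * complex.Re (dot x y) + rnorm y ^+ 2.
Proof.
rewrite -!Re_dotzz dotDl !dotDr !raddfD /= (Re_dotC y x); ring.
Qed.

Lemma rnormBZ_sqr x y c :
  rnorm (x - c *: y) ^+ 2 = rnorm x ^+ 2
    - 2 * (complex.Re c * complex.Re (dot x y)
           + complex.Im c * complex.Im (dot x y))
    + sqmod c * rnorm y ^+ 2.
Proof.
rewrite rnormD_sqr rnormN rnormZ_sqr dotNr dotZr.
by case: c (dot x y) => a b [p q] /=; ring.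
Qed.

(** Completing the square in [c]. The factor [rnorm y ^+ 2] on both sides
    clears the denominator of the optimal [c]. *)
Lemma dist_line_ge x y c :
  rnorm x ^+ 2 * rnorm y ^+ 2 - sqmod (dot x y)
    <= rnorm (x - c *: y) ^+ 2 * rnorm y ^+ 2.
Proof.
rewrite rnormBZ_sqr /sqmod.
move: (rnorm x) (rnorm y) => p q; case: c (dot x y) => a b [u v] /=.
rewrite -subr_ge0.
rewrite [leRHS](_ : _ = (a * q ^+ 2 - u) ^+ 2 + (b * q ^+ 2 - v) ^+ 2).
  by rewrite addr_ge0 ?sqr_ge0.
by ring.
Qed.

Lemma dist_line_min x y : exists c,
  rnorm (x - c *: y) ^+ 2 * rnorm y ^+ 2
    = rnorm x ^+ 2 * rnorm y ^+ 2 - sqmod (dot x y).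
Proof.
have [->|/rnorm_gt0 y0] := eqVneq y 0.
  by exists 0; rewrite scaler0 subr0 rnorm0 expr0n !mulr0 dot0r sqmod0 subr0.
exists ((rnorm y ^- 2)%:C * dot x y).
rewrite rnormBZ_sqr sqmodM sqmod_real /sqmod.
have : rnorm y != 0 by rewrite gt_eqF.
move: (rnorm x) (rnorm y) => p q; case: (dot x y) => u v q0 /=.
by rewrite !mul0r subr0 addr0; field.
Qed.

Lemma cauchy_schwarz x y : sqmod (dot x y) <= rnorm x ^+ 2 * rnorm y ^+ 2.
Proof.
have [c] := dist_line_min x y.
move=> e; rewrite -subr_ge0 -e.
by rewrite mulr_ge0 ?sqr_ge0.
Qed.

Lemma Re_le_sqmod c : complex.Re c ^+ 2 <= sqmod c.
Proof. by rewrite lerDl sqr_ge0. Qed.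

Lemma Re_dot_le x y : `|complex.Re (dot x y)| <= rnorm x * rnorm y.
Proof.
rewrite -(@ler_pXn2r _ 2) ?nnegrE ?mulr_ge0 ?rnorm_ge0//.
rewrite real_normK ?num_real// exprMn.
exact: le_trans (Re_le_sqmod _) (cauchy_schwarz _ _).
Qed.

Lemma unit_factor z : z != 0 ->
  exists a y, [/\ 0 < a, rnorm y = 1 & z = a%:C *: y].
Proof.
move=> /rnorm_gt0 z0; exists (rnorm z), ((rnorm z)^-1%:C *: z); split=> //.
  by rewrite rnormZr ger0_norm ?invr_ge0 ?ltW// mulVf ?gt_eqF.
by rewrite scalerA -rmorphM mulfV ?gt_eqF// scale1r.
Qed.

End InnerProduct.

(** * Operator norms *)

Section OperatorNorm.
Variables (R : realType) (H : completeNormedModType R[i]).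
Implicit Types (T : H -> H) (x y z : H) (C K : R).

Lemma homogeneous0 T : (forall c z, T (c *: z) = c *: T z) -> T 0 = 0.
Proof. by move=> TZ; have := TZ 0 0; rewrite !scale0r. Qed.

Lemma opnorm_le T K : 0 <= K -> (forall z, rnorm (T z) <= K * rnorm z) ->
  opnorm T <= K.
Proof.
move=> K0 TK; apply: ge_sup.
  by exists (rnorm (T 0)), 0 => //=; rewrite rnorm0.
move=> _ [z /= z1 <-]; apply: le_trans (TK z) _.
by rewrite -[leRHS]mulr1 ler_wpM2l.
Qed.

Lemma le_opnorm T C : (forall c z, T (c *: z) = c *: T z) ->
  (forall z, rnorm (T z) <= C * rnorm z) ->
  forall z, rnorm (T z) <= opnorm T * rnorm z.
Proof.
move=> TZ TC z; have [->|z0] := eqVneq z 0.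
  by rewrite homogeneous0// rnorm0 mulr0.
have [a [y [a0 y1 ->]]] := unit_factor z0.
rewrite TZ !rnormZr y1 mulr1 [leRHS]mulrC ler_wpM2l//.
apply: ub_le_sup; last by exists y => //=; rewrite y1.
exists `|C| => _ [x /= x1 <-]; apply: le_trans (TC x) _.
apply: le_trans (ler_wpM2r (rnorm_ge0 _) (ler_norm C)) _.
by rewrite -[leRHS]mulr1 ler_wpM2l.
Qed.

Lemma opnorm_ge0 T C : (forall c z, T (c *: z) = c *: T z) ->
  (forall z, rnorm (T z) <= C * rnorm z) -> (exists z : H, z != 0) ->
  0 <= opnorm T.
Proof.
move=> TZ TC [z z0]; rewrite -(pmulr_lge0 _ (rnorm_gt0 z0)).
exact: le_trans (rnorm_ge0 _) (le_opnorm TZ TC z).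
Qed.

Lemma opnorm_approx T K : (forall c z, T (c *: z) = c *: T z) ->
  (exists z : H, z != 0) -> K < opnorm T ->
  exists2 z, rnorm z = 1 & K < rnorm (T z).
Proof.
move=> TZ [z z0] KT; apply: contrapT => noz.
have le_unit y : rnorm y = 1 -> rnorm (T y) <= K.
  by move=> y1; rewrite leNgt; apply/negP => Ky; apply: noz; exists y.
have [a [x [_ x1 _]]] := unit_factor z0.
have K0 : 0 <= K := le_trans (rnorm_ge0 _) (le_unit _ x1).
move: KT; rewrite ltNge => /negP; apply; apply: opnorm_le => // y.
have [->|y0] := eqVneq y 0.
  by rewrite homogeneous0// rnorm0 mulr0.
have [b [u [b0 u1 ->]]] := unit_factor y0.
by rewrite TZ !rnormZr u1 mulr1 mulrC ler_wpM2r// le_unit.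
Qed.

Lemma bounded_rnorm (T : {linear H -> H}) : bounded_near T (nbhs (0 : H)) ->
  exists2 C, 0 < C & forall z, rnorm (T z) <= C * rnorm z.
Proof.
move=> /linear_boundedP/pinfty_ex_gt0[r r0 Tr].
have rE : (complex.Re r)%:C = r by rewrite RRe_real// gtr0_real.
exists (complex.Re r); first by rewrite -ltcR rE.
by move=> z; have := Tr z; rewrite -!rnormE -{1}rE -rmorphM lecR.
Qed.

End OperatorNorm.

(** * Spans and GMRES residuals *)

Section Spans.
Variables (R : realType) (H : completeNormedModType R[i]).
Implicit Types (x y z : H) (c : R[i]).

Lemma lin_span0 n (e : 'I_n -> H) : lin_span e 0.
Proof. by exists (fun=> 0) => //; rewrite big1// => i _; rewrite scale0r. Qed.

Lemma lin_spanD n (e : 'I_n -> H) x y :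
  lin_span e x -> lin_span e y -> lin_span e (x + y).
Proof.
move=> [c _ <-] [d _ <-]; exists (fun i => c i + d i) => //.
by rewrite -big_split; apply: eq_bigr => i _; rewrite scalerDl.
Qed.

Lemma lin_spanZ n (e : 'I_n -> H) c x : lin_span e x -> lin_span e (c *: x).
Proof.
move=> [d _ <-]; exists (fun i => c * d i) => //.
by rewrite scaler_sumr; apply: eq_bigr => i _; rewrite scalerA.
Qed.

Lemma lin_spanB n (e : 'I_n -> H) x y :
  lin_span e x -> lin_span e y -> lin_span e (x - y).
Proof. by move=> ex ey; rewrite -scaleN1r; apply/lin_spanD/lin_spanZ. Qed.

Lemma lin_span_gen n (e : 'I_n -> H) i : lin_span e (e i).
Proof.
exists (fun j => (j == i)%:R) => //; rewrite (bigD1 i)//= eqxx scale1r.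
by rewrite big1 ?addr0// => j /negPf ->; rewrite scale0r.
Qed.

Lemma lin_span_image n m (e : 'I_n -> H) (e' : 'I_m -> H)
    (f : {linear H -> H}) x :
  (forall i, lin_span e' (f (e i))) -> lin_span e x -> lin_span e' (f x).
Proof.
move=> fe [c _ <-]; rewrite linear_sum.
apply: big_ind => [||i _]; first exact: lin_span0.
  by move=> y z; apply: lin_spanD.
by rewrite linearZ_LR; apply/lin_spanZ/fe.
Qed.

Lemma lin_span_recl n (e : 'I_n.+1 -> H) z : lin_span e z ->
  exists c y, lin_span (fun i => e (lift ord0 i)) y /\ z = c *: e ord0 + y.
Proof.
move=> [c _ <-]; rewrite big_ord_recl; do 2 eexists; split; last reflexivity.
by exists (fun i => c (lift ord0 i)).
Qed.

Lemma lin_span_lift n (e : 'I_n.+1 -> H) z :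
  lin_span (fun i => e (lift ord0 i)) z -> lin_span e z.
Proof.
apply: (lin_span_image (f := idfun)) => i; exact: lin_span_gen.
Qed.

End Spans.

Section Projection.
Variables (R : realType) (H : completeNormedModType R[i]).
Variable dot : {dot H for Num.conj}.
Hypothesis dotE : forall z : H, dot z z = `|z| ^+ 2.
Implicit Types (x y z : H) (c : R[i]).

Lemma dot_lin_span0 n (e : 'I_n -> H) x y :
  (forall i, dot x (e i) = 0) -> lin_span e y -> dot x y = 0.
Proof.
move=> xe [c _ <-]; rewrite linear_sum big1 //= => i _.
by rewrite dotZr xe mulr0.
Qed.

(** One Gram-Schmidt step per generator: the first generator is replaced by its
    component [v] orthogonal to the others, and the projection on these is then
    corrected along [v]. *)
Lemma orthogonal_projection n (e : 'I_n -> H) x :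
  exists2 y, lin_span e y & forall i, dot (x - y) (e i) = 0.
Proof.
elim: n e x => [|n IH] e x.
  by exists 0; [exact: lin_span0 | case].
pose e' i := e (lift ord0 i).
have [y ey yP] := IH e' x; have [w ew wP] := IH e' (e ord0).
pose v := e ord0 - w.
have ve : lin_span e v.
  by apply: lin_spanB; [exact: lin_span_gen | exact: lin_span_lift].
have [c cP] : exists c, dot (x - y - c *: v) v = 0.
  have [v0|v0] := eqVneq (dot v v) 0.
    exists 0; have -> : v = 0 by apply: rnorm_eq0; apply/eqP;
      rewrite -sqrf_eq0 -(Re_dotzz dotE) v0.
    exact: dot0r.
  exists (dot (x - y) v / dot v v).
  by rewrite (dotDl dot) (dotNl dot) (dotZl dot) divfK ?subrr.
have ortho_e' i : dot (x - y - c *: v) (e' i) = 0.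
  by rewrite (dotDl dot) (dotNl dot) (dotZl dot) yP wP mulr0 subr0.
exists (y + c *: v).
  by apply: lin_spanD; [exact: lin_span_lift | exact: lin_spanZ].
move=> i; rewrite opprD addrA; case: (unliftP ord0 i) => [j|] ->; last first.
  rewrite -[e ord0](subrK w) -/v (dotDr dot) cP add0r.
  exact: dot_lin_span0 ortho_e' ew.
exact: ortho_e'.
Qed.

Lemma orthogonal_min n (e : 'I_n -> H) x y z :
  lin_span e y -> (forall i, dot (x - y) (e i) = 0) -> lin_span e z ->
  rnorm (x - y) <= rnorm (x - z).
Proof.
move=> ey xye ez; rewrite -(@ler_pXn2r _ 2) ?nnegrE ?rnorm_ge0//.
have -> : x - z = (x - y) + (y - z) by rewrite addrA subrK.
rewrite (rnormD_sqr dotE (x - y)) (dot_lin_span0 xye).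
  by rewrite mulr0 addr0 lerDl sqr_ge0.
exact: lin_spanB.
Qed.

(** The minimum defining the residual exists since [T] maps the Krylov space
    onto the span of the images of its generators, on which [r0] has an
    orthogonal projection. *)
Lemma gmres_residualP (T : {linear H -> H}) k r0 :
  is_gmres_residual T k r0 (gmres_residual T k r0).
Proof.
apply: (@xgetPex _ 0 (is_gmres_residual T k r0)).
pose e (i : 'I_k) := T (iter i T r0).
have Te x : krylov T k r0 x -> lin_span e (T x).
  by apply: lin_span_image => i; apply: (lin_span_gen e).
have eT y : lin_span e y -> exists2 x, krylov T k r0 x & y = T x.
  move=> [c _ <-]; exists (\sum_i c i *: iter i T r0); first by exists c.
  by rewrite linear_sum; apply: eq_bigr => i _; rewrite linearZ_LR.
have [y ey yP] := orthogonal_projection e r0.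
have [x Kx yTx] := eT y ey.
exists (r0 - y); split.
  exists (- x); last by rewrite raddfN yTx.
  by rewrite -scaleN1r; apply: lin_spanZ.
move=> _ [z Kz <-]; rewrite -[T z]opprK.
by apply: orthogonal_min ey yP _; rewrite -scaleN1r; apply/lin_spanZ/Te.
Qed.

End Projection.

Section Residuals.
Variables (R : realType) (H : completeNormedModType R[i]).
Variable dot : {dot H for Num.conj}.
Hypothesis dotE : forall z : H, dot z z = `|z| ^+ 2.
Variable T : {linear H -> H}.
Implicit Types (x y z : H) (c : R[i]).

Lemma gmres_residual0 z : gmres_residual T 0 z = z.
Proof.
have [[x [c _ <-]]] := gmres_residualP dotE T 0 z.
by rewrite big_ord0 raddf0 addr0 => <-.
Qed.

Lemma gmres_residual1 z : exists c, gmres_residual T 1 z = z - c *: T z.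
Proof.
have [[x [c _ <-]] <- _] := gmres_residualP dotE T 1 z.
by exists (- c ord0); rewrite big_ord1 linearZ_LR scaleNr opprK.
Qed.

(** With [r = r0 + T x] and [x] in the [k]-th Krylov space, the right-hand side
    is [r0 + T (x - c *: (r0 + T x))], a competitor of the next residual. *)
Lemma gmres_step k z c :
  rnorm (gmres_residual T k.+1 z)
    <= rnorm (gmres_residual T k z - c *: T (gmres_residual T k z)).
Proof.
set r := gmres_residual T k z; have [[x Kx rE] _] := gmres_residualP dotE T k z.
have [_] := gmres_residualP dotE T k.+1 z; apply.
exists (x - c *: (z + T x)); last first.
  by rewrite rE /r -rE linearB linearZ_LR addrA.
have K_gen j : (j < k.+1)%N -> krylov T k.+1 z (iter j T z).
  move=> jk.
  exact: (lin_span_gen (fun i : 'I_k.+1 => iter i T z) (Ordinal jk)).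
apply: lin_spanB.
  apply: (lin_span_image (f := idfun)) Kx => i.
  by apply: K_gen; rewrite ltnS ltnW.
apply/lin_spanZ/lin_spanD; first exact: (K_gen 0%N).
by apply: lin_span_image Kx => i; apply: (K_gen i.+1); rewrite ltnS.
Qed.

Lemma gmres_mono k z :
  rnorm (gmres_residual T k.+1 z) <= rnorm (gmres_residual T k z).
Proof. by have /= := gmres_step k z 0; rewrite scale0r subr0. Qed.

End Residuals.

(** * Convexity of numerical ranges *)

Section ToeplitzHausdorff.
Variables (R : realType) (H : completeNormedModType R[i]).
Variable dot : {dot H for Num.conj}.
Hypothesis dotE : forall z : H, dot z z = `|z| ^+ 2.
Implicit Types (x y z : H) (c d u : R[i]) (a b s t : R).

Lemma quadratic_ivt (a b c : R) : c <= 0 <= a + b + c ->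
  exists2 t : R, 0 <= t <= 1 & a * t ^+ 2 + b * t + c = 0.
Proof.
move=> c0; pose p := a%:P * 'X^2 + b%:P * 'X + c%:P.
have pE t : p.[t] = a * t ^+ 2 + b * t + c.
  by rewrite /p !(hornerD, hornerM, hornerC, hornerXn, hornerX).
have [||t t01 /rootP pt] := @poly_ivt R p 0 1; first exact: ler01.
  by rewrite !pE expr0n expr1n !mulr0 !add0r !mulr1.
by exists t => //; rewrite -pE.
Qed.

(** The imaginary part is a real-linear form in [u], so it vanishes at least on
    a line; of the two opposite unit vectors of this line, one satisfies the
    last inequality. *)
Lemma choose_phase c d e : exists u : R[i],
  [/\ sqmod u = 1, complex.Im (u^* * c + u * d) = 0
    & 0 <= complex.Re (u^* * e)].
Proof.
suff [u [u1 u2]] : exists u : R[i],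
    sqmod u = 1 /\ complex.Im (u^* * c + u * d) = 0.
  have [u3|u3] := leP 0 (complex.Re (u^* * e)); first by exists u.
  exists (- u); split.
  - by rewrite -u1 /sqmod !raddfN /= !sqrrN.
  - by rewrite rmorphN !mulNr -opprD raddfN /= u2 oppr0.
  - by rewrite rmorphN mulNr raddfN oppr_ge0 ltW.
case: c d => c1 c2 [d1 d2]; set p := c2 + d2; set q := d1 - c1.
have [pq0|pq0] := eqVneq (p ^+ 2 + q ^+ 2) 0.
  exists 1; split; first by rewrite /sqmod /= expr0n expr1n addr0.
  move/eqP: pq0; rewrite paddr_eq0 ?sqr_ge0// !sqrf_eq0 => /andP[/eqP p0 _].
  by rewrite /= -[RHS]p0 /p; ring.
have n0 : Num.sqrt (p ^+ 2 + q ^+ 2) ^+ 2 = p ^+ 2 + q ^+ 2.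
  by rewrite sqr_sqrtr ?addr_ge0 ?sqr_ge0.
move: (Num.sqrt _) n0 => n nE; have n0 : n != 0 by rewrite -sqrf_eq0 nE.
exists (Complex (- q / n) (p / n)); split; rewrite /sqmod /=.
  by rewrite !exprMn !exprVn nE -mulrDl sqrrN addrC mulfV.
by rewrite /p /q; field.
Qed.

Variable phi : H -> H -> R[i].
Hypothesis phiDl : forall x y z, phi (x + y) z = phi x z + phi y z.
Hypothesis phiDr : forall x y z, phi z (x + y) = phi z x + phi z y.
Hypothesis phiZl : forall c x z, phi (c *: x) z = c * phi x z.
Hypothesis phiZr : forall c x z, phi z (c *: x) = c^* * phi z x.

(** With [w1 = phi x x] and [w2 = phi y y], a suitable phase [u] makes
    [phi z z - w1 * |z|^2] a real multiple of [w2 - w1] for all the vectors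
    [z = (1 - t) *: x + t *: (u *: y)], and the intermediate value theorem
    picks [t]. The phase also makes the norm of [z] at least that of
    [(1 - t, t)], whence the bound on the coefficients of the normalized
    vector. *)
Lemma toeplitz_hausdorff x y s : rnorm x = 1 -> rnorm y = 1 -> 0 <= s <= 1 ->
  exists c d, [/\ sqmod c + sqmod d <= 1, rnorm (c *: x + d *: y) = 1
    & phi (c *: x + d *: y) (c *: x + d *: y)
      = (1 - s)%:C * phi x x + s%:C * phi y y].
Proof.
move=> x1 y1 /andP[s0 s1].
set w1 := phi x x; set w2 := phi y y.
have [w12|w12] := eqVneq (w2 - w1) 0.
  exists 1, 0; rewrite scale1r scale0r addr0 sqmod0 addr0; split=> //.
    by rewrite /sqmod /= expr1n expr0n addr0.
  rewrite -/w1 (_ : w2 = w1); last by apply/eqP; rewrite -subr_eq0 w12.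
  by rewrite -mulrDl -rmorphD subrK mul1r.
(* On unit vectors, [psi] is [phi] up to an affine change of values that yields
   [0] at [x] and [1] at [y]. *)
pose psi p q := (phi p q - w1 * dot p q) / (w2 - w1).
have [u [u1 u2 u3]] := choose_phase (psi x y) (psi y x) (dot x y).
set k := u^* * psi x y + u * psi y x in u2.
set r := complex.Re (u^* * dot x y) in u3.
have kE : k = (complex.Re k)%:C by case: k u2 => ? ? /= ->.
(* The equation says that [psi z z = s * |z|^2] for the vector [z] below. *)
have [t t01 tE] : exists2 t : R, 0 <= t <= 1 &
    t ^+ 2 + t * (1 - t) * complex.Re k
      - s * ((1 - t) ^+ 2 + t ^+ 2 + 2 * t * (1 - t) * r) = 0.
  have [|t t01 tE] := @quadratic_ivt (1 - complex.Re k - s * (2 - 2 * r))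
    (complex.Re k - s * (2 * r - 2)) (- s).
    by rewrite oppr_le0 s0/=; move: (complex.Re k) => m; lra.
  by exists t => //; rewrite -tE; ring.
set z := (1 - t)%:C *: x + (t%:C * u) *: y.
have zE : rnorm z ^+ 2 = (1 - t) ^+ 2 + t ^+ 2 + 2 * t * (1 - t) * r.
  rewrite (rnormD_sqr dotE) !rnormZ_sqr sqmodM !sqmod_real u1 x1 y1 expr1n.
  rewrite !mulr1 dotZl dotZr. rewrite conj_realM.
  have -> : complex.Re ((1 - t)%:C * (t%:C * u^* * dot x y)) = (1 - t) * t * r.
    by rewrite -mulrA mulrA -rmorphM /r; case: (u^* * _) => v1 v2 /=; ring.
  ring.
have zge : (1 - t) ^+ 2 + t ^+ 2 <= rnorm z ^+ 2.
  case/andP: t01 => t0 t1.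
  by rewrite zE lerDl mulr_ge0 ?mulr_ge0 ?subr_ge0.
have z0 : 0 < rnorm z.
  rewrite lt_neqAle rnorm_ge0 andbT eq_sym; apply/eqP => z0.
  by have := sqr_ge0 (1 - 2 * t); move: zge; rewrite z0 expr0n /=; nra.
have uu : u^* * u = 1.
  by rewrite mul_conj u1.
have phizE : phi z z = (rnorm z ^+ 2)%:C * ((1 - s)%:C * w1 + s%:C * w2).
  have -> : (rnorm z ^+ 2)%:C * ((1 - s)%:C * w1 + s%:C * w2)
      = (rnorm z ^+ 2)%:C * w1 + (s * rnorm z ^+ 2)%:C * (w2 - w1).
    by rewrite !rmorphM !rmorphB rmorph1; ring.
  have -> : s * rnorm z ^+ 2 = t ^+ 2 + t * (1 - t) * complex.Re k.
    by rewrite zE; apply/eqP; rewrite eq_sym -subr_eq0 tE.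
  have -> : (t ^+ 2 + t * (1 - t) * complex.Re k)%:C
      = t%:C * t%:C + t%:C * (1 - t%:C) * k.
    rewrite [k in RHS]kE; apply/eqP.
    by rewrite eq_complex /=; apply/andP; split; apply/eqP; ring.
  have -> : (rnorm z ^+ 2)%:C = dot z z.
    by rewrite dotE -rnormE rmorphXn.
  have psiE p q : psi p q * (w2 - w1) = phi p q - w1 * dot p q by rewrite divfK.
  have kw : k * (w2 - w1)
      = u^* * (phi x y - w1 * dot x y) + u * (phi y x - w1 * dot y x).
    by rewrite -!psiE /k; ring.
  rewrite [(_ + _ * k) * _]mulrDl -[_ * k * _]mulrA kw.
  rewrite /z !(phiDl, phiDr, phiZl, phiZr) !(dotDl, dotDr, dotZl, dotZr).
  rewrite -/w1 -/w2.
  have -> : dot x x = 1 by rewrite dotE -rnormE x1 expr1n.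
  have -> : dot y y = 1 by rewrite dotE -rnormE y1 expr1n.
  have -> : (1 - t)%:C = 1 - t%:C :> R[i] by rewrite rmorphB.
  have -> : (1 - t%:C)^* = 1 - t%:C :> R[i].
    by rewrite rmorphB rmorph1 /= conj_real.
  rewrite !conj_realM.
  move: (u^*) uu => v uv; move: (t%:C) => T.
  by ring: uv.
have nz0 : rnorm z ^+ 2 != 0 by rewrite sqrf_eq0 gt_eqF.
pose n := (rnorm z)^-1%:C.
exists (n * (1 - t)%:C), (n * (t%:C * u)).
rewrite -!(scalerA n) -scalerDr -/z; split.
- rewrite !sqmodM !sqmod_real u1 mulr1 -mulrDr exprVn mulrC.
  by rewrite ler_pdivrMr ?mul1r// exprn_gt0.
- by rewrite rnormZr ger0_norm ?invr_ge0 ?ltW// mulVf ?gt_eqF.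
- have nn : n * n * (rnorm z ^+ 2)%:C = 1.
    by rewrite -!rmorphM -invfM -expr2 mulVf.
  by rewrite phiZl phiZr phizE conj_real [n * (n * _)]mulrA mulrA nn mul1r.
Qed.

End ToeplitzHausdorff.

(** * The minimax theorem for the pencil of an operator *)

Section Minimax.
Variables (R : realType) (H : completeNormedModType R[i]).
Variable dot : {dot H for Num.conj}.
Hypothesis dotE : forall z : H, dot z z = `|z| ^+ 2.
Hypothesis H_neq0 : exists z : H, z != 0.
Variables (B : {linear H -> H}) (C c : R).
Hypotheses (C0 : 0 < C) (BC : forall z, rnorm (B z) <= C * rnorm z).
Hypotheses (c0 : 0 < c) (Bc : forall z, c * rnorm z <= rnorm (B z)).
Implicit Types (x y z : H) (l m u : R[i]) (a b s t e : R).

Definition pencil l z := z - l *: B z.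

Lemma pencilZ l d z : pencil l (d *: z) = d *: pencil l z.
Proof. by rewrite /pencil linearZ_LR scalerBr !scalerA mulrC. Qed.

Lemma pencilD l x y : pencil l (x + y) = pencil l x + pencil l y.
Proof. by rewrite /pencil linearD scalerDr opprD addrACA. Qed.

Lemma pencil_shift l m z : pencil (l + m) z = pencil l z - m *: B z.
Proof. by rewrite /pencil scalerDl opprD addrA. Qed.

Lemma pencil_bound l z :
  rnorm (pencil l z) <= (1 + Num.sqrt (sqmod l) * C) * rnorm z.
Proof.
rewrite mulrDl mul1r; apply: le_trans (rnormB _ _) _.
by rewrite lerD2l rnormZ -mulrA ler_wpM2l ?sqrtr_ge0.
Qed.

Let F l := opnorm (pencil l).

Lemma pencil_le l z : rnorm (pencil l z) <= F l * rnorm z.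
Proof. exact: le_opnorm (pencilZ l) (pencil_bound l) z. Qed.

Lemma pencil_opnorm_ge0 l : 0 <= F l.
Proof. exact: opnorm_ge0 (pencilZ l) (pencil_bound l) H_neq0. Qed.

Lemma pencil_opnorm_lip l m : F (l + m) <= F l + C * Num.sqrt (sqmod m).
Proof.
apply: opnorm_le => [|z].
  by rewrite addr_ge0 ?pencil_opnorm_ge0// mulr_ge0 ?sqrtr_ge0// ltW.
rewrite pencil_shift; apply: le_trans (rnormB _ _) _.
rewrite mulrDl lerD ?pencil_le// rnormZ.
by rewrite [leRHS]mulrAC mulrC ler_wpM2r ?sqrtr_ge0.
Qed.

Lemma sqrt_sqmod_le a b : Num.sqrt (sqmod (Complex a b)) <= `|a| + `|b|.
Proof.
rewrite -(@ler_pXn2r _ 2) ?nnegrE ?sqrtr_ge0 ?addr_ge0//.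
rewrite sqr_sqrtr ?sqmod_ge0// sqrrD !real_normK ?num_real// /sqmod /=.
by rewrite lerD2r lerDl mulrn_wge0 ?mulr_ge0.
Qed.

Let G (p : R * R) := F (Complex p.1 p.2).

Lemma pencil_opnorm_continuous : continuous G.
Proof.
move=> p; apply/cvgrPdist_lt => e e0; pose d := e / (C *+ 3).
have d0 : 0 < d by rewrite divr_gt0 ?pmulrn_lgt0.
apply: filterS (nbhsx_ballx p d d0) => q [/= q1 q2].
have lip (v w : R * R) : `|v.1 - w.1| < d -> `|v.2 - w.2| < d -> G v - G w < e.
  move=> vw1 vw2; rewrite ltrBlDl /G.
  have -> : Complex v.1 v.2
      = Complex w.1 w.2 + Complex (v.1 - w.1) (v.2 - w.2).
    by apply/eqP; rewrite eq_complex /= !subrKC !eqxx.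
  apply: le_lt_trans (pencil_opnorm_lip _ _) _; rewrite ltrD2l.
  apply: le_lt_trans (ler_wpM2l (ltW C0) (sqrt_sqmod_le _ _)) _.
  have -> : e = C * (d * 3) by rewrite /d -mulr_natr; field; rewrite gt_eqF.
  by rewrite ltr_pM2l//; lra.
have := lip p q q1 q2; have := lip q p.
rewrite ![`|q.1 - _|]distrC ![`|q.2 - _|]distrC.
by move=> /(_ q1 q2) qp pq; rewrite ltr_norml pq andbT ltrNl opprB.
Qed.

Lemma pencil_opnorm_attained : exists l0, forall l, F l0 <= F l.
Proof.
(* Outside this box, [|l| * |B z| >= 2] for unit [z], so that the norm at [l] is
   at least [1] and hence at least the norm at [0]. *)
pose K := 2 / c; have K0 : 0 <= K by rewrite divr_ge0// ltW.
pose box := `[- K, K]%classic `*` `[- K, K]%classic.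
have inbox p : box p <-> (- K <= p.1 <= K) /\ (- K <= p.2 <= K).
  by rewrite /box /setX /= !in_itv.
have box0 : box (0, 0) by apply/inbox; rewrite /= oppr_le0 K0.
have cbox : compact box by apply: compact_setX; exact: segment_compact.
have [|p pbox pmin] := @compact_EVT_min _ _ G box (ex_intro _ _ box0) cbox.
  exact/continuous_subspaceT/pencil_opnorm_continuous.
exists (Complex p.1 p.2) => -[a b].
have [ab|nab] := pselect (box (a, b)).
  by apply: (pmin (a, b)); rewrite inE.
apply: le_trans (pmin (0, 0) _) _; first by rewrite inE.
have F0 : G (0, 0) <= 1.
  apply: opnorm_le => // z; rewrite mul1r /pencil.
  by rewrite (_ : Complex _ _ = 0)// scale0r subr0.
apply: le_trans F0 _.
have Kab : K <= Num.sqrt (sqmod (Complex a b)).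
  rewrite leNgt; apply/negP => abK; apply: nab; apply/inbox.
  have le_of d : d ^+ 2 <= sqmod (Complex a b) -> - K <= d <= K.
    move=> dab; rewrite -ler_norml; apply: le_trans (ltW abK).
    by rewrite -sqrtr_sqr ler_wsqrtr.
  by split; apply: le_of; rewrite /sqmod /= ?lerDl ?lerDr sqr_ge0.
have [z z0] := H_neq0; have [_ [y [_ y1 _]]] := unit_factor z0.
have : rnorm (Complex a b *: B y) <= rnorm (pencil (Complex a b) y) + rnorm y.
  have -> : Complex a b *: B y = - (pencil (Complex a b) y - y).
    by rewrite /pencil !opprB subrKC.
  by rewrite rnormN rnormB.
have := pencil_le (Complex a b) y; rewrite y1 mulr1 rnormZ => Fab abF.
have : K * c <= Num.sqrt (sqmod (Complex a b)) * rnorm (B y).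
  by rewrite ler_pM ?(ltW c0)//; have := Bc y; rewrite y1 mulr1.
have -> : K * c = 2 by rewrite divfK ?gt_eqF.
lra.
Qed.

Section AtMinimum.
Variable l0 : R[i].
Hypothesis l0_min : forall l, F l0 <= F l.
Let N := F l0.
Hypothesis N0 : 0 < N.
Let A z := pencil l0 z.
Let phi x y := dot (A x) (B y).

Let AN z : rnorm (A z) <= N * rnorm z. Proof. exact: pencil_le. Qed.

Let AD x y : A (x + y) = A x + A y. Proof. exact: pencilD. Qed.

Let AZ l z : A (l *: z) = l *: A z. Proof. exact: pencilZ. Qed.

Let phi_le z : rnorm z = 1 -> sqmod (phi z z) <= (N * C) ^+ 2.
Proof.
move=> z1; apply: le_trans (cauchy_schwarz dotE _ _) _.
have := AN z; have := BC z; rewrite z1 !mulr1 exprMn => ? ?.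
by rewrite ler_pM ?sqr_ge0// ler_sqr_nneg ?rnorm_ge0.
Qed.

(** A unit vector almost attaining the norm at [l0 + t u], for a small [t > 0],
    also almost attains the norm at [l0]. Since the former norm is at least the
    latter, the first-order term in [t] of the squared norm of
    [A z - t u B z] cannot be much below zero. *)
Lemma minimizer_direction u e : 0 < e -> exists z,
  [/\ rnorm z = 1, N ^+ 2 - rnorm (A z) ^+ 2 <= e
    & complex.Re (u^* * phi z z) <= e].
Proof.
move=> e0; pose q := sqmod u * C ^+ 2; pose M := N * (Num.sqrt (sqmod u) * C).
have q0 : 0 <= q by rewrite mulr_ge0 ?sqmod_ge0 ?sqr_ge0.
have M0 : 0 <= M by rewrite !mulr_ge0 ?sqrtr_ge0// ltW.
have K0 : 0 < 1 + q + 2 * M by lra.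
(* [M] bounds the first-order term in [t] and [1 + q] the second-order ones. *)
have [t [t0 t1 tK]] : exists t, [/\ 0 < t, t <= 1 & t * (1 + q + 2 * M) <= e].
  exists (Num.min 1 (e / (1 + q + 2 * M))).
  rewrite lt_min ltr01 divr_gt0// ge_min lexx; split=> //.
  by rewrite -ler_pdivlMr// ge_min lexx orbT.
have NtF : Num.sqrt (N ^+ 2 - t ^+ 2) < F (l0 + t%:C * u).
  apply: lt_le_trans (l0_min _).
  have [pos|neg] := leP 0 (N ^+ 2 - t ^+ 2); last by rewrite ltr0_sqrtr.
  rewrite -(@ltr_pXn2r _ 2) ?nnegrE ?sqrtr_ge0 ?(ltW N0)//.
  by rewrite sqr_sqrtr// ltrBlDr ltrDl exprn_gt0.
have [z z1 zP] := opnorm_approx (pencilZ _) H_neq0 NtF.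
rewrite pencil_shift -/(A z) in zP.
have {}zP : N ^+ 2 - t ^+ 2 <= rnorm (A z - (t%:C * u) *: B z) ^+ 2.
  apply: le_trans (_ : Num.sqrt (N ^+ 2 - t ^+ 2) ^+ 2 <= _); last first.
    by rewrite ler_sqr_nneg ?sqrtr_ge0 ?ltW.
  have [pos|neg] := leP 0 (N ^+ 2 - t ^+ 2); first by rewrite sqr_sqrtr.
  by rewrite (le_trans (ltW neg)) ?sqr_ge0.
have AzN : rnorm (A z) <= N by have := AN z; rewrite z1 mulr1.
have BzC : rnorm (B z) <= C by have := BC z; rewrite z1 mulr1.
have Az2 : rnorm (A z) ^+ 2 <= N ^+ 2 by rewrite ler_sqr_nneg ?rnorm_ge0.
have Bz2 : rnorm (B z) ^+ 2 <= C ^+ 2 by rewrite ler_sqr_nneg ?rnorm_ge0.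
have ReE : complex.Re (t%:C * u) * complex.Re (phi z z)
    + complex.Im (t%:C * u) * complex.Im (phi z z)
    = t * complex.Re (u^* * phi z z).
  by case: (u) (phi z z) => ? ? [? ?] /=; ring.
rewrite (rnormBZ_sqr dotE) -/(phi z z) ReE sqmodM sqmod_real in zP.
have uphi : `|complex.Re (u^* * phi z z)| <= M.
  rewrite -(dotZr dot); apply: le_trans (Re_dot_le dotE _ _) _.
  by rewrite ler_pM ?rnorm_ge0// rnormZ ler_wpM2l ?sqrtr_ge0.
move: uphi; rewrite ler_norml => /andP[uphi _].
have uB : t ^+ 2 * sqmod u * rnorm (B z) ^+ 2 <= t ^+ 2 * q.
  by rewrite -mulrA ler_wpM2l ?sqr_ge0// ler_wpM2l ?sqmod_ge0.
have tt : t ^+ 2 * (1 + q) <= t * (1 + q).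
  by rewrite ler_wpM2r ?expr2 ?ger_pMl//; lra.
exists z; split=> //; move: (complex.Re (u^* * _)) uphi zP => X uphi zP.
  have tX : - (t * M) <= t * X by rewrite -mulrN ler_wpM2l// ltW.
  nra.
have tM : 0 <= t * M by rewrite mulr_ge0// ltW.
have : 2 * X <= t * (1 + q) by rewrite -(ler_pM2l t0); nra.
lra.
Qed.

Let defect z := N ^+ 2 * rnorm z ^+ 2 - rnorm (A z) ^+ 2.

Let defect_ge0 z : 0 <= defect z.
Proof.
by rewrite subr_ge0 -exprMn ler_sqr_nneg ?rnorm_ge0.
Qed.

Let defectZ l z : defect (l *: z) = sqmod l * defect z.
Proof. by rewrite /defect AZ !rnormZ_sqr; ring. Qed.

(** The parallelogram law for the positive semidefinite form [defect]. *)
Let defectD x y : defect (x + y) <= 2 * defect x + 2 * defect y.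
Proof.
have : 0 <= defect (x - y) by exact: defect_ge0.
have AB : A (x - y) = A x - A y by rewrite -scaleN1r AD AZ scaleN1r.
have sqB v w : rnorm (v - w) ^+ 2
    = rnorm v ^+ 2 - 2 * complex.Re (dot v w) + rnorm w ^+ 2.
  by rewrite (rnormD_sqr dotE) rnormN (dotNr dot) raddfN /=; ring.
rewrite /defect AB AD (sqB x) (sqB (A x)).
by rewrite (rnormD_sqr dotE x) (rnormD_sqr dotE (A x)); lra.
Qed.

(** The quantifier over [d] makes [small] a property of the maximizing
    sequences of [A], although the vectors may have no limit. *)
Let small e := forall d, 0 < d -> exists z,
  [/\ rnorm z = 1, defect z <= d & sqmod (phi z z) <= e].

Let S := (N * C) ^+ 2.

Let S0 : 0 < S. Proof. by rewrite exprn_gt0 ?mulr_gt0. Qed.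

Let small_S : small S.
Proof.
move=> d d0; have [z [z1 zd _]] := minimizer_direction 0 d0.
by exists z; split; rewrite ?phi_le// /defect z1 expr1n mulr1.
Qed.

(** From a value [w1] of [phi] with [sqmod w1 <= e] one moves towards a value
    [w2] with [w1^* * w2] of almost nonpositive real part: the cross term of the
    squared modulus of [(1 - s) w1 + s w2] is then harmless. *)
Let small_step e : 0 < e -> e <= S -> small e -> small (e - e ^+ 2 / (4 * S)).
Proof.
move=> e0 eS es d d0.
have d20 : 0 < d / 2 by rewrite divr_gt0.
have [x [x1 xd xe]] := es _ d20.
pose r := Num.min (d / 2) (e ^+ 2 / (4 * S)).
have r0 : 0 < r by rewrite lt_min d20 divr_gt0 ?exprn_gt0 ?mulr_gt0.
have [y [y1 yd ye]] := minimizer_direction (phi x x) r0.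
have {}yd : defect y <= d / 2.
  by rewrite /defect y1 expr1n mulr1; apply: le_trans yd _; rewrite ge_min lexx.
have {}ye : complex.Re ((phi x x)^* * phi y y) <= e ^+ 2 / (4 * S).
  by apply: le_trans ye _; rewrite ge_min lexx orbT.
(* This [s] minimizes [e - 2 * s * e + 2 * s ^+ 2 * S], which bounds
   [(1 - s) ^+ 2 * e + s ^+ 2 * S]. *)
pose s := e / (2 * S).
have sS : s * (2 * S) = e by rewrite divfK// mulf_neq0 ?gt_eqF.
have s0 : 0 < s by rewrite divr_gt0 ?mulr_gt0.
have eE : e ^+ 2 / (4 * S) = s * e / 2.
  by rewrite /s; field; rewrite gt_eqF.
have s12 : s <= 1 / 2 by rewrite ler_pdivrMr ?mulr_gt0//; lra.
clearbody s; have s01 : 0 <= s <= 1 by rewrite ltW//=; lra.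
have [||||a [b [ab1 z1 zE]]] :=
  @toeplitz_hausdorff _ _ _ dotE phi _ _ _ _ _ _ _ x1 y1 s01.
- by move=> *; rewrite /phi AD (dotDl dot).
- by move=> *; rewrite /phi linearD (dotDr dot).
- by move=> *; rewrite /phi AZ (dotZl dot).
- by move=> *; rewrite /phi linearZ_LR (dotZr dot).
exists (a *: x + b *: y); split=> //.
  apply: le_trans (defectD _ _) _; rewrite !defectZ.
  have := sqmod_ge0 a; have := sqmod_ge0 b; nra.
rewrite zE.
have -> : sqmod ((1 - s)%:C * phi x x + s%:C * phi y y) =
    (1 - s) ^+ 2 * sqmod (phi x x)
    + 2 * s * (1 - s) * complex.Re ((phi x x)^* * phi y y)
    + s ^+ 2 * sqmod (phi y y).
  by rewrite /sqmod; case: (phi x x) (phi y y) => ? ? [? ?] /=; ring.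
have := phi_le y1; rewrite -/S.
rewrite eE in ye *.
move: (sqmod (phi x x)) xe => p pe; move: (sqmod (phi y y)) => q qS.
move: (complex.Re _) ye => v ve.
have h1 : (1 - s) ^+ 2 * p <= (1 - s) ^+ 2 * e by rewrite ler_wpM2l ?sqr_ge0.
have h2 : s ^+ 2 * q <= s ^+ 2 * S by rewrite ler_wpM2l ?sqr_ge0.
have h3 : 2 * s * (1 - s) * v <= 2 * s * (1 - s) * (s * e / 2).
  by rewrite ler_wpM2l// !mulr_ge0//; [exact: ltW | lra].
have sse : s ^+ 2 * S = s * e / 2 by rewrite -sS; field.
have : 0 <= (1 - s) ^+ 2 * (s * e) by rewrite mulr_ge0 ?sqr_ge0 ?mulr_ge0 ?ltW.
nra.
Qed.

(** At a positive infimum of the small numbers, [small_step] would lead to a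
    number below the infimum. *)
Let small_all e : 0 < e -> small e.
Proof.
move=> e0; pose D := [set e | small e].
have D_ge0 : lbound D 0.
  by move=> d /(_ 1 ltr01)[z [_ _]]; apply: le_trans (sqmod_ge0 _).
have D_inf : has_inf D by split; [exists S; exact: small_S | exists 0].
have small_le a b : a <= b -> small a -> small b.
  by move=> ab sa d /sa[z [? ? za]]; exists z; split=> //; exact: le_trans ab.
have [m0|m0] := leP (inf D) 0.
  have [d Dd de] := inf_adherent e0 D_inf.
  by apply: small_le Dd; lra.
have g0 : 0 < inf D ^+ 2 / (4 * S) by rewrite divr_gt0 ?exprn_gt0 ?mulr_gt0.
have [d Dd dm] := inf_adherent g0 D_inf.
have md : inf D <= d by apply: ge_inf => //; exists 0.
have mS : inf D <= S by apply: ge_inf => //; exists 0.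
pose f := Num.min d S.
have Df : small f by rewrite /f; case: leP.
have f0 : 0 < f by rewrite lt_min (lt_le_trans m0 md).
have mf : inf D <= f by rewrite le_min md mS.
have fS : f <= S by rewrite ge_min lexx orbT.
have fd : f <= d by rewrite ge_min lexx.
have : inf D <= f - f ^+ 2 / (4 * S).
  by apply: ge_inf; [exists 0 | exact: small_step].
have : inf D ^+ 2 / (4 * S) <= f ^+ 2 / (4 * S).
  by rewrite ler_pM2r ?invr_gt0 ?mulr_gt0// ler_sqr_nneg// ltW.
lra.
Qed.

(** For almost orthogonal [A z] and [B z], all [A z - m *: B z] are almost as
    long as [A z]. *)
Lemma minimax_at_minimizer e : 0 < e ->
  exists2 z, rnorm z = 1 & forall l, N ^+ 2 - e <= rnorm (pencil l z) ^+ 2.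
Proof.
move=> e0; have e20 : 0 < e / 2 by rewrite divr_gt0.
have ce0 : 0 < c ^+ 2 * (e / 2) by rewrite mulr_gt0 ?exprn_gt0.
have [z [z1 zd ze]] := small_all ce0 e20.
exists z => // l; have := dist_line_ge dotE (A z) (B z) (l - l0).
rewrite -/(phi z z) -pencil_shift subrKC.
have Bz : c ^+ 2 <= rnorm (B z) ^+ 2.
  have := Bc z; rewrite z1 mulr1 => cB.
  by rewrite ler_sqr_nneg ?(ltW c0).
have Bz0 : 0 < rnorm (B z) ^+ 2 by apply: lt_le_trans Bz; rewrite exprn_gt0.
move: zd; rewrite /defect z1 expr1n mulr1 => zd h.
rewrite -(ler_pM2r Bz0); apply: le_trans h; nra.
Qed.

End AtMinimum.

(** The nontrivial inequality between the supremum over [z] of the infimum over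
    [l] and the infimum of the supremum; the supremum over [z] need not be
    attained, whence [e]. *)
Theorem minimax e : 0 < e -> exists2 z, rnorm z = 1 &
  forall l, inf [set opnorm (pencil l) | l in [set: R[i]]] ^+ 2 - e
    <= rnorm (pencil l z) ^+ 2.
Proof.
move=> e0; have [l0 l0_min] := pencil_opnorm_attained.
have -> : inf [set opnorm (pencil l) | l in [set: R[i]]] = F l0.
  apply/eqP; rewrite eq_le; apply/andP; split.
    apply: ge_inf; last by exists l0.
    by exists 0 => _ [l _ <-]; exact: pencil_opnorm_ge0.
  by apply: lb_le_inf; [exists (F l0), l0 | move=> _ [l _ <-]; exact: l0_min].
have [N0|N0] := leP (F l0) 0; last exact: minimax_at_minimizer.
have [z z0] := H_neq0; have [_ [y [_ y1 _]]] := unit_factor z0.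
exists y => // l; have -> : F l0 = 0.
  by apply/eqP; rewrite eq_le N0 pencil_opnorm_ge0.
by rewrite expr0n/= sub0r (le_trans _ (sqr_ge0 _))// oppr_le0 ltW.
Qed.

End Minimax.

(** * The linear reduction factor *)

Section ReductionFactor.
Variables (R : realType) (H : completeNormedModType R[i]).
Variable dot : {dot H for Num.conj}.
Hypothesis dotE : forall z : H, dot z z = `|z| ^+ 2.
Variable T : {linear H -> H}.
Implicit Types (x y z : H) (K : R).

Let factor_ub : ubound [set q | exists (z : H) k, (0 < k)%N /\
  q = rnorm (gmres_residual T k z) / rnorm (gmres_residual T k.-1 z)] 1.
Proof.
move=> _ [z [[|k] [// _ ->]]] /=.
have [->|r0] := rnorm_eq0_or_gt0 (gmres_residual T k z).
  by rewrite invr0 mulr0.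
by rewrite ler_pdivrMr ?mul1r// (gmres_mono dotE).
Qed.

Lemma reduction_factor_ge0 : 0 <= linear_reduction_factor T.
Proof.
apply: le_trans (_ : rnorm (gmres_residual T 1 (0 : H))
  / rnorm (gmres_residual T 0 (0 : H)) <= _).
  by rewrite divr_ge0 ?rnorm_ge0.
by apply: ub_le_sup; [exists 1; exact: factor_ub | exists 0, 1%N].
Qed.

Lemma reduction_factor_step k z : rnorm (gmres_residual T k.+1 z)
  <= linear_reduction_factor T * rnorm (gmres_residual T k z).
Proof.
have [r0|r0] := rnorm_eq0_or_gt0 (gmres_residual T k z).
  by rewrite r0 mulr0 -r0 (gmres_mono dotE).
rewrite -ler_pdivrMr//.
by apply: ub_le_sup; [exists 1; exact: factor_ub | exists z, k.+1].
Qed.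

(** The hypothesis speaks of first steps only, since a later step reduces at
    least as much as a first step from the current residual. *)
Lemma reduction_factor_le K : 0 <= K ->
  (forall z, exists l, rnorm (z - l *: T z) <= K * rnorm z) ->
  linear_reduction_factor T <= K.
Proof.
move=> K0 TK; apply: ge_sup.
  exists (rnorm (gmres_residual T 1 (0 : H))
    / rnorm (gmres_residual T 0 (0 : H))).
  by exists 0, 1%N.
move=> _ [z [[|k] [// _ ->]]] /=.
have [l lK] := TK (gmres_residual T k z).
have [->|r0] := rnorm_eq0_or_gt0 (gmres_residual T k z).
  by rewrite invr0 mulr0.
by rewrite ler_pdivrMr// (le_trans (gmres_step dotE T k z l)).
Qed.

Lemma first_step_le M z :
  rnorm (gmres_residual T 1 z) <= M * rnorm (gmres_residual T 0 z) ->
  exists l, rnorm (z - l *: T z) <= M * rnorm z.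
Proof.
rewrite (gmres_residual0 dotE); have [l ->] := gmres_residual1 dotE T z.
by exists l.
Qed.

(** The right-hand side, which compares the squared cosine of the angle between
    [x] and [y] with [1 - K ^+ 2], is symmetric in [x] and [y]. *)
Lemma reducibleP x y K : 0 <= K -> y != 0 ->
  (exists l, rnorm (x - l *: y) <= K * rnorm x)
  <-> (1 - K ^+ 2) * (rnorm x ^+ 2 * rnorm y ^+ 2) <= sqmod (dot x y).
Proof.
move=> K0 /rnorm_gt0 y0; have y20 : 0 < rnorm y ^+ 2 by rewrite exprn_gt0.
split=> [[l lK]|xy].
  have := dist_line_ge dotE x y l.
  have : rnorm (x - l *: y) ^+ 2 * rnorm y ^+ 2
      <= K ^+ 2 * rnorm x ^+ 2 * rnorm y ^+ 2.
    by rewrite ler_pM2r// -exprMn ler_sqr_nneg ?rnorm_ge0.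
  lra.
have [l lE] := dist_line_min dotE x y; exists l.
rewrite -(@ler_pXn2r _ 2) ?nnegrE ?mulr_ge0 ?rnorm_ge0//.
rewrite -(ler_pM2r y20) lE exprMn; lra.
Qed.

End ReductionFactor.

Section PencilNorm.
Variables (R : realType) (H : completeNormedModType R[i]).
Variable dot : {dot H for Num.conj}.
Hypothesis dotE : forall z : H, dot z z = `|z| ^+ 2.
Hypothesis H_neq0 : exists z : H, z != 0.
Variables (T : {linear H -> H}) (C c : R).
Hypotheses (C0 : 0 < C) (TC : forall z, rnorm (T z) <= C * rnorm z).
Hypotheses (c0 : 0 < c) (Tc : forall z, c * rnorm z <= rnorm (T z)).

Lemma reduction_factorE :
  linear_reduction_factor T = inf [set opnorm (pencil T l) | l in [set: R[i]]].
Proof.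
set n := inf _; have M0 := reduction_factor_ge0 dotE T.
apply/eqP; rewrite eq_le; apply/andP; split.
  apply: lb_le_inf; first by exists (opnorm (pencil T 0)), 0.
  move=> _ [l _ <-]; apply: (reduction_factor_le dotE).
    exact: pencil_opnorm_ge0 H_neq0 _ _ TC l.
  by move=> z; exists l; exact: (pencil_le TC).
rewrite leNgt; apply/negP => Mn.
have e0 : 0 < (n ^+ 2 - linear_reduction_factor T ^+ 2) / 2.
  by rewrite divr_gt0// subr_gt0 ltr_pXn2r// nnegrE// ltW// (le_lt_trans M0).
have [z z1 zP] := minimax dotE H_neq0 C0 TC c0 Tc e0.
have [l] := first_step_le dotE (reduction_factor_step dotE T 0 z).
rewrite z1 mulr1 => /(ler_sqr_nneg (rnorm_ge0 _)).
by have := zP l; rewrite -/n /pencil; lra.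
Qed.

End PencilNorm.

(** * Numerical ranges of an operator and of its inverse *)

Section NumericalRange.
Variables (R : realType) (H : completeNormedModType R[i]).
Variable dot : {dot H for Num.conj}.
Hypothesis dotE : forall z : H, dot z z = `|z| ^+ 2.
Hypothesis H_neq0 : exists z : H, z != 0.
Implicit Types (x y z w : H) (K : R).

Lemma numrange_nonempty T :
  [set complex.Re `|l| | l in numrange dot T] !=set0.
Proof.
have [z z0] := H_neq0; have [_ [y [_ y1 _]]] := unit_factor z0.
by exists (complex.Re `|dot (T y) y|), (dot (T y) y) => //; exists y.
Qed.

Lemma nu_ge0 T : 0 <= nu dot T.
Proof.
apply: lb_le_inf; first exact: numrange_nonempty.
by move=> _ [l _ <-]; rewrite Re_norm sqrtr_ge0.
Qed.

Lemma nu_ge T K :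
  (forall z, rnorm z = 1 -> K <= Num.sqrt (sqmod (dot (T z) z))) -> K <= nu dot T.
Proof.
move=> TK; apply: lb_le_inf; first exact: numrange_nonempty.
by move=> _ [_ [z /= z1 <-] <-]; apply: le_trans (TK z z1) _; rewrite -Re_norm.
Qed.

Lemma nu_le (T : {linear H -> H}) z :
  nu dot T * rnorm z ^+ 2 <= Num.sqrt (sqmod (dot (T z) z)).
Proof.
have [->|z0] := eqVneq z 0; first by rewrite rnorm0 expr0n mulr0 sqrtr_ge0.
have [a [y [a0 y1 ->]]] := unit_factor z0.
rewrite (linearZ_LR T) (dotZl dot) (dotZr dot) !sqmodM conj_real sqmod_real.
rewrite mulrA -expr2 sqrtrM ?sqr_ge0// sqrtr_sqr ger0_norm ?sqr_ge0//.
rewrite rnormZ_sqr y1 sqmod_real expr1n mulr1 mulrC ler_wpM2l ?sqr_ge0//.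
apply: ge_inf; first by exists 0 => _ [l _ <-]; rewrite Re_norm sqrtr_ge0.
by exists (dot (T y) y); [exists y | rewrite -Re_norm].
Qed.

Lemma numrange0P (T : {linear H -> H}) :
  numrange dot T 0 <-> exists2 z, z != 0 & dot (T z) z = 0.
Proof.
split=> [[z /= z1 Tz]|[z z0]].
  exists z => //; apply/eqP => z0; move: z1; rewrite z0 rnorm0 => /esym/eqP.
  by rewrite oner_eq0.
have [a [y [a0 y1 ->]]] := unit_factor z0.
rewrite (linearZ_LR T) (dotZl dot) (dotZr dot) conj_real => /eqP.
have aC0 : a%:C != 0 :> R[i] by rewrite fmorph_eq0 gt_eqF.
by rewrite !mulf_eq0 (negPf aC0)/= => /eqP Ty; exists y.
Qed.

Lemma nu_gt0_numrange (T : {linear H -> H}) :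
  0 < nu dot T -> ~ numrange dot T 0.
Proof.
move=> nu0 [z /= z1 Tz]; have := nu_le T z.
by rewrite Tz sqmod0 sqrtr0 z1 expr1n mulr1 leNgt nu0.
Qed.

Lemma sqmod_dotC x y : sqmod (dot x y) = sqmod (dot y x).
Proof. by rewrite (dotC dot y x) sqmodJ. Qed.

Section Inverse.
Variables (T U : {linear H -> H}).
Hypotheses (TK : cancel T U) (UK : cancel U T).
Variables (C c : R).
Hypotheses (C0 : 0 < C) (TC : forall z, rnorm (T z) <= C * rnorm z).
Hypotheses (c0 : 0 < c) (Tc : forall z, c * rnorm z <= rnorm (T z)).

Lemma inv_neq0 w : w != 0 -> U w != 0.
Proof. by apply: contra_neq => Uw; rewrite -(UK w) Uw linear0. Qed.

(** With [z = U w], the operator [T] reduces [z] along [w] whereas [U] reduces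
    [w] along [z]. *)
Lemma reduction_factor_inv_le :
  linear_reduction_factor U <= linear_reduction_factor T.
Proof.
have M0 := reduction_factor_ge0 dotE T.
apply: (reduction_factor_le dotE) => // w.
have [->|w0] := eqVneq w 0.
  by exists 0; rewrite scale0r subr0 rnorm0 mulr0.
apply/(reducibleP dotE) => //; first exact: inv_neq0.
have := first_step_le dotE (reduction_factor_step dotE T 0 (U w)).
rewrite UK => /(reducibleP dotE _ M0 w0).
by rewrite sqmod_dotC [_ ^+ 2 * _]mulrC.
Qed.

Lemma numrange0_inv : numrange dot U 0 -> numrange dot T 0.
Proof.
move=> /numrange0P[w w0 Uw]; apply/numrange0P; exists (U w).
  exact: inv_neq0.
by rewrite UK (dotC dot) Uw rmorph0.
Qed.

Lemma sqmod_dot_inv z : sqmod (dot (U (T z)) (T z)) = sqmod (dot (T z) z).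
Proof. by rewrite TK sqmod_dotC. Qed.

(** The number [dot (T z) z] is, up to conjugation, also a value of the
    quadratic form of [U], namely at [T z]. *)
Lemma nu_mul_le z : nu dot T * nu dot U * (rnorm z ^+ 2 * rnorm (T z) ^+ 2)
  <= sqmod (dot (T z) z).
Proof.
rewrite -[leRHS]sqr_sqrtr ?sqmod_ge0// [leRHS]expr2 mulrACA.
have := nu_le U (T z); rewrite sqmod_dot_inv => Uz.
by apply: ler_pM; rewrite ?nu_le// mulr_ge0 ?nu_ge0 ?sqr_ge0.
Qed.

Lemma nu_mul_le1 : nu dot T * nu dot U <= 1.
Proof.
have [z z0] := H_neq0; have [_ [y [_ y1 _]]] := unit_factor z0.
have Ty : 0 < rnorm (T y) by apply: lt_le_trans (Tc y); rewrite y1 mulr1.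
have Ty2 : 0 < rnorm (T y) ^+ 2 by rewrite exprn_gt0.
rewrite -(ler_pM2r Ty2) mul1r.
have := le_trans (nu_mul_le y) (cauchy_schwarz dotE _ _).
by rewrite y1 expr1n mul1r mulr1.
Qed.

Lemma reduction_factor_nu :
  linear_reduction_factor T <= Num.sqrt (1 - nu dot T * nu dot U).
Proof.
apply: (reduction_factor_le dotE) => [|z]; first exact: sqrtr_ge0.
have [->|z0] := eqVneq z 0.
  by exists 0; rewrite scale0r subr0 rnorm0 mulr0.
have Tz : T z != 0 by apply: contra_neq z0 => Tz; rewrite -(TK z) Tz linear0.
apply/(reducibleP dotE z (sqrtr_ge0 _) Tz).
rewrite sqr_sqrtr ?subr_ge0 ?nu_mul_le1// subKr sqmod_dotC.
exact: nu_mul_le.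
Qed.

Lemma opnorm_gt0 : 0 < opnorm T.
Proof.
have [z z0] := H_neq0; have [_ [y [_ y1 _]]] := unit_factor z0.
have := le_opnorm (fun a x => linearZ_LR T a x) TC y; rewrite y1 mulr1.
by apply: lt_le_trans; apply: lt_le_trans (Tc y); rewrite y1 mulr1.
Qed.

Lemma nu_inv_ge : nu dot T / opnorm T ^+ 2 <= nu dot U.
Proof.
apply: nu_ge => w w1; rewrite ler_pdivrMr ?exprn_gt0 ?opnorm_gt0//.
have := le_opnorm (fun a x => linearZ_LR T a x) TC (U w); rewrite UK w1.
move=> /(ler_sqr_nneg ler01); rewrite expr1n exprMn => Tw.
have := nu_le T (U w); rewrite -sqmod_dot_inv UK => nuw.
apply: le_trans (ler_wpM2r (sqr_ge0 _) nuw).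
by rewrite -mulrA -[leLHS]mulr1 ler_wpM2l ?nu_ge0// mulrC.
Qed.

Lemma nu_inv_gt0 : 0 < nu dot T -> 0 < nu dot U.
Proof.
move=> nu0; apply: lt_le_trans nu_inv_ge.
by rewrite divr_gt0// exprn_gt0// opnorm_gt0.
Qed.

Lemma linear_gmres_nu : linear_gmres_convergence T -> 0 < nu dot T.
Proof.
move=> [M M1 TM].
have M0 : 0 <= M.
  have [z z0] := H_neq0; have [_ [y [_ y1 _]]] := unit_factor z0.
  have := TM 1%N y isT; rewrite /= (gmres_residual0 dotE) y1 mulr1.
  exact: le_trans (rnorm_ge0 _).
have M2 : 0 < 1 - M ^+ 2 by rewrite subr_gt0 expr_lt1.
have d0 : 0 < (1 - M ^+ 2) * c ^+ 2 by rewrite mulr_gt0 ?exprn_gt0.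
apply: (@lt_le_trans _ _ (Num.sqrt ((1 - M ^+ 2) * c ^+ 2))).
  by rewrite sqrtr_gt0.
apply: nu_ge => z z1; rewrite ler_wsqrtr// sqmod_dotC.
have cT : c <= rnorm (T z) by have := Tc z; rewrite z1 mulr1.
have Tz0 : T z != 0.
  by apply/eqP => Tz; move: cT; rewrite Tz rnorm0 leNgt c0.
have /(reducibleP dotE _ M0 Tz0) := first_step_le dotE (TM 1%N z isT).
apply: le_trans; rewrite z1 expr1n mul1r ler_wpM2l ?(ltW M2)//.
by rewrite ler_sqr_nneg ?(ltW c0).
Qed.

Lemma nu_linear_gmres : 0 < nu dot T -> linear_gmres_convergence T.
Proof.
move=> nuT; have nuU := nu_inv_gt0 nuT.
exists (linear_reduction_factor T); last first.
  by move=> [//|k] r0 _; exact: reduction_factor_step.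
apply: le_lt_trans reduction_factor_nu _.
rewrite -[ltRHS]sqrtr1 ltr_sqrt// ltrBlDr ltrDl mulr_gt0//.
Qed.

Lemma strictly_monotone_numrange :
  strictly_monotone_gmres_convergence T -> ~ numrange dot T 0.
Proof.
move=> Tmono [z /= z1 Tz]; have := Tmono 1%N z isT.
rewrite /= (gmres_residual0 dotE) z1 => -[|/eqP]; last by rewrite oner_eq0.
have [l ->] := gmres_residual1 dotE T z; apply/negP; rewrite -leNgt.
rewrite -(@ler_pXn2r _ 2) ?nnegrE ?rnorm_ge0// (rnormBZ_sqr dotE).
have -> : dot z (T z) = 0 by rewrite (dotC dot) Tz rmorph0.
rewrite !mulr0 addr0 mulr0 subr0 z1 expr1n lerDl.
by rewrite mulr_ge0 ?sqmod_ge0 ?sqr_ge0.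
Qed.

Lemma numrange_strictly_monotone :
  ~ numrange dot T 0 -> strictly_monotone_gmres_convergence T.
Proof.
move=> T0 [//|k] z _ /=; set r := gmres_residual T k z.
have [->|r0] := eqVneq r 0; [by right; rewrite rnorm0 | left].
have Tr0 : dot (T r) r != 0.
  by apply/eqP => Tr; apply: T0; apply/numrange0P; exists r.
have [l lE] := dist_line_min dotE r (T r).
apply: le_lt_trans (gmres_step dotE T k z l) _; rewrite -/r.
have Trn : 0 < rnorm (T r) ^+ 2.
  rewrite exprn_gt0// rnorm_gt0//; apply: contra_neq Tr0 => ->.
  by rewrite (dotC dot) (dot0r dot) rmorph0.
rewrite -(@ltr_pXn2r _ 2) ?nnegrE ?rnorm_ge0// -(ltr_pM2r Trn) lE.
rewrite ltrBlDr ltrDl lt_neqAle sqmod_ge0 andbT eq_sym.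
by apply: contra_neq Tr0 => /sqmod_eq0 Tr; rewrite (dotC dot) Tr rmorph0.
Qed.

End Inverse.

End NumericalRange.

(** * Numerical ranges avoiding zero: finite dimension and self-adjointness *)

Section FiniteDimension.
Variables (R : realType) (H : completeNormedModType R[i]).
Variable dot : {dot H for Num.conj}.
Hypothesis dotE : forall z : H, dot z z = `|z| ^+ 2.
Implicit Types (x y z v : H) (C r : R).

Lemma Complex_scale_continuous v :
  continuous (fun p : R * R => Complex p.1 p.2 *: v).
Proof.
move=> p; apply/cvgrPdist_lt => e e0.
have eE : (complex.Re e)%:C = e by rewrite RRe_real// gtr0_real.
have {}e0 : 0 < complex.Re e by rewrite -ltcR eE.
pose d := complex.Re e / (2 * (rnorm v + 1)).
have v1 : 0 < rnorm v + 1 by have := rnorm_ge0 v; lra.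
have d0 : 0 < d by rewrite divr_gt0// mulr_gt0.
apply: filterS (nbhsx_ballx p d d0) => q [/= q1 q2].
rewrite -eE -rnormE ltcR -scalerBl rnormZ.
have -> : Complex p.1 p.2 - Complex q.1 q.2 = Complex (p.1 - q.1) (p.2 - q.2).
  by [].
apply: le_lt_trans (ler_wpM2r (rnorm_ge0 _) (sqrt_sqmod_le _ _)) _.
have -> : complex.Re e = 2 * d * (rnorm v + 1).
  by rewrite /d; field; rewrite gt_eqF.
have := rnorm_ge0 v; rewrite /ball /= in q1 q2; nra.
Qed.

(** Induction on the generators: along the component [v] of the first generator
    orthogonal to the others, a vector of the unit ball has a bounded
    coefficient, and its remainder is in the unit ball of the smaller span. A
    compact superset of the ball is easier to propagate than compactness of the
    ball itself. *)
Lemma span_ball_compact n (e : 'I_n -> H) : exists2 K : set H, compact K &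
  forall z, lin_span e z -> rnorm z <= 1 -> K z.
Proof.
elim: n e => [|n IH] e.
  exists [set 0]; first exact: compact_set1.
  by move=> z [c _ <-] _; rewrite big_ord0.
pose e' i := e (lift ord0 i).
have [K cK eK] := IH e'.
have [w ew wP] := orthogonal_projection dotE e' (e ord0).
set v := e ord0 - w in wP.
have decomp z : lin_span e z -> exists c y, lin_span e' y /\ z = y + c *: v.
  move=> /lin_span_recl[c [y [ey ->]]]; exists c, (y + c *: w); split.
    by apply: lin_spanD => //; apply: lin_spanZ.
  by rewrite /v scalerBr addrA addrAC addrK addrC.
have [v0|v0] := eqVneq v 0.
  exists K => // z /decomp[c [y [ey ->]]]; rewrite v0 scaler0 addr0; exact: eK.
have vn0 := rnorm_gt0 v0; pose r := (rnorm v)^-1.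
pose f (p : H * (R * R)) := p.1 + Complex p.2.1 p.2.2 *: v.
exists (f @` (K `*` (`[- r, r]%classic `*` `[- r, r]%classic))).
  apply: continuous_compact; last first.
    by do 2?apply: compact_setX => //; exact: segment_compact.
  apply: continuous_subspaceT => p; apply: cvgD; first exact: cvg_fst.
  apply: (@cvg_comp _ _ _ snd (fun q : R * R => Complex q.1 q.2 *: v) _ _ _ cvg_snd).
  exact: Complex_scale_continuous.
move=> _ /decomp[[a b] [y [ey ->]]] z1; exists (y, (a, b)) => //.
have : rnorm (y + Complex a b *: v) ^+ 2 <= 1.
  by rewrite -(expr1n _ 2) ler_sqr_nneg ?rnorm_ge0.
rewrite (rnormD_sqr dotE) (dotZr dot) (dotC dot v).
have -> : dot v y = 0 by apply: (dot_lin_span0 wP).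
rewrite rmorph0 mulr0 mulr0 addr0 rnormZ_sqr => yab.
have le_r t : t ^+ 2 <= sqmod (Complex a b) -> - r <= t <= r.
  move=> tab; rewrite -ler_norml -(@ler_pXn2r _ 2) ?nnegrE ?invr_ge0 ?rnorm_ge0//.
  rewrite real_normK ?num_real// exprVn -[leRHS]mul1r.
  rewrite ler_pdivlMr ?exprn_gt0//.
  apply: le_trans yab; apply: le_trans (ler_wpM2r (sqr_ge0 _) tab) _.
  by rewrite lerDr sqr_ge0.
split=> /=; last first.
  by split; rewrite /= in_itv /= le_r// /sqmod /= ?lerDl ?lerDr sqr_ge0.
apply: eK => //; rewrite -(@ler_pXn2r _ 2) ?nnegrE ?rnorm_ge0// expr1n.
by apply: le_trans yab; rewrite lerDl mulr_ge0 ?sqmod_ge0 ?sqr_ge0.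
Qed.

Lemma quadratic_form_continuous (T : {linear H -> H}) C : 0 < C ->
  (forall z, rnorm (T z) <= C * rnorm z) ->
  forall u : R[i], continuous (fun z => complex.Re (u * dot (T z) z)).
Proof.
move=> C0 TC u x; apply/cvgrPdist_lt => e e0.
pose D := Num.sqrt (sqmod u) * C.
have D0 : 0 <= D by rewrite mulr_ge0 ?sqrtr_ge0 ?ltW.
pose K := 1 + D * (2 * rnorm x + 1).
have K0 : 0 < K.
  by rewrite ltr_wpDr// mulr_ge0// addr_ge0// mulr_ge0// rnorm_ge0.
pose d := Num.min 1 (e / K).
have d0 : 0 < d by rewrite lt_min ltr01 divr_gt0.
have dC0 : 0 < d%:C :> R[i] by rewrite ltcR.
apply: filterS (nbhsx_ballx x d%:C dC0) => y.
rewrite -ball_normE /= -rnormE ltcR => xy.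
have -> : complex.Re (u * dot (T x) x) - complex.Re (u * dot (T y) y)
    = complex.Re (dot (u *: T (x - y)) x) + complex.Re (dot (u *: T y) (x - y)).
  rewrite -!raddfB -raddfD /= !(dotZl dot) -mulrDr -mulrBr linearB.
  by rewrite (dotDl dot) (dotNl dot) (dotDr dot) (dotNr dot) addrA subrK.
apply: le_lt_trans (ler_normD _ _) _.
have bound a b : `|complex.Re (dot (u *: T a) b)| <= D * rnorm a * rnorm b.
  apply: le_trans (Re_dot_le dotE _ _) _; rewrite ler_wpM2r ?rnorm_ge0//.
  by rewrite rnormZ -mulrA ler_wpM2l ?sqrtr_ge0.
apply: le_lt_trans (lerD (bound _ _) (bound _ _)) _.
have d1 : d <= 1 by rewrite ge_min lexx.
have dK : d * K <= e by rewrite -ler_pdivlMr// ge_min lexx orbT.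
have yx : rnorm y <= rnorm x + 1.
  have -> : y = x - (x - y) by rewrite subKr.
  by apply: le_trans (rnormB _ _) _; rewrite lerD2l (le_trans (ltW xy)).
apply: lt_le_trans dK.
have x0 := rnorm_ge0 x; have xy0 := rnorm_ge0 (x - y).
have h1 : rnorm (x - y) * (D * (rnorm x + rnorm y))
    <= d * (D * (2 * rnorm x + 1)).
  apply: ler_pM => //.
    by rewrite mulr_ge0// addr_ge0 ?rnorm_ge0.
    exact: ltW.
  by rewrite ler_wpM2l//; lra.
rewrite /K; lra.
Qed.

(** On a compact set covering the unit sphere, [sqmod (dot (T z) z)] plus a
    penalty vanishing exactly on the sphere is positive, hence bounded below. *)
Lemma finite_dimensional_nu (T : {linear H -> H}) C : 0 < C ->
  (forall z, rnorm (T z) <= C * rnorm z) -> (exists z : H, z != 0) ->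
  finite_dimensional H -> ~ numrange dot T 0 -> 0 < nu dot T.
Proof.
move=> C0 TC H_neq0 [n [e eT]] T0.
have [K cK KP] := span_ball_compact e.
have {}KP z : rnorm z = 1 -> K z by move=> z1; apply: KP; rewrite ?eT ?z1.
pose q (U : H -> H) u z := complex.Re (u * dot (U z) z).
(* Multiplication by ['i] exposes the imaginary part, up to sign. *)
pose g z := q T 1 z ^+ 2 + q T 'i%C z ^+ 2 + (1 - q idfun 1 z) ^+ 2.
have gE z : g z = sqmod (dot (T z) z) + (1 - rnorm z ^+ 2) ^+ 2.
  rewrite /g /q -(Re_dotzz dotE) /= !mul1r; congr (_ + _).
  by rewrite /sqmod; case: (dot (T z) z) => a b /=; ring.
have qc u : continuous (q T u) by exact: quadratic_form_continuous TC u.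
have qid u : continuous (q idfun u).
  by apply: (@quadratic_form_continuous idfun 1) => // z; rewrite mul1r.
have gc : continuous g.
  have sqc (h : H -> R) : continuous h -> continuous (fun z => h z ^+ 2).
    by move=> hc z; apply: (@cvgM _ _ _ _ h h); exact: hc.
  move=> z; apply: cvgD; last first.
    by apply: sqc => y; apply: cvgB; [exact: cvg_cst | exact: qid].
  by apply: cvgD; apply: sqc; exact: qc.
have [z0 z0P] := H_neq0; have [_ [y [_ y1 _]]] := unit_factor z0P.
have [|x _ xmin] := compact_EVT_min (ex_intro _ y (KP y y1)) cK (f := g).
  exact: continuous_subspaceT.
have gx : 0 < g x.
  rewrite lt_neqAle gE addr_ge0 ?sqmod_ge0 ?sqr_ge0// andbT eq_sym.
  apply/negP; rewrite paddr_eq0 ?sqmod_ge0 ?sqr_ge0// sqrf_eq0 subr_eq0.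
  move=> /andP[/eqP/sqmod_eq0 Tx /eqP x1]; apply: T0; exists x => //=.
  by apply/eqP; rewrite -(@eqrXn2 _ 2) ?rnorm_ge0// expr1n -x1.
apply: (@lt_le_trans _ _ (Num.sqrt (g x))); first by rewrite sqrtr_gt0.
apply: nu_ge => // z z1; rewrite ler_wsqrtr//.
have := xmin z; rewrite inE => /(_ (KP z z1)) xz; apply: le_trans xz _.
by rewrite gE z1 expr1n subrr expr0n addr0.
Qed.

End FiniteDimension.

Section SelfAdjoint.
Variables (R : realType) (H : completeNormedModType R[i]).
Variable dot : {dot H for Num.conj}.
Hypothesis dotE : forall z : H, dot z z = `|z| ^+ 2.
Hypothesis H_neq0 : exists z : H, z != 0.
Variables (T : {linear H -> H}) (C c : R).
Hypotheses (C0 : 0 < C) (TC : forall z, rnorm (T z) <= C * rnorm z).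
Hypotheses (c0 : 0 < c) (Tc : forall z, c * rnorm z <= rnorm (T z)).
Hypothesis Tsa : selfadjoint dot T.
Implicit Types (x y z : H).

Let q z := complex.Re (dot (T z) z).

Let dot_real z : dot (T z) z = (q z)%:C.
Proof.
have : complex.Im (dot (T z) z) = - complex.Im (dot (T z) z).
  by rewrite -(Im_dotC dot) Tsa.
rewrite /q; case: (dot (T z) z) => a b /= bb.
by apply/eqP; rewrite eq_complex /= eqxx/=; apply/eqP; lra.
Qed.

(** By convexity of the numerical range, the quadratic form of [T] does not
    change sign. *)
Lemma selfadjoint_sign : ~ numrange dot T 0 ->
  exists2 s : R, s ^+ 2 = 1 & forall z, 0 <= s * q z.
Proof.
move=> T0.
have q0 z : rnorm z = 1 -> q z != 0.
  by move=> z1; apply/eqP => qz; apply: T0; exists z; rewrite //= dot_real qz.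
have no_sign_change x y : rnorm x = 1 -> rnorm y = 1 -> 0 < q x -> 0 < q y.
  move=> x1 y1 qx; rewrite ltNge le_eqVlt (negPf (q0 _ y1))/=; apply/negP => qy.
  pose t := q x / (q x - q y).
  have d0 : 0 < q x - q y by lra.
  have t01 : 0 <= t <= 1.
    by rewrite /t divr_ge0 ?(ltW d0) ?(ltW qx)//= ler_pdivrMr// mul1r; lra.
  have [||||a [b [_ z1 zE]]] := @toeplitz_hausdorff _ _ _ dotE
    (fun v w => dot (T v) w) _ _ _ _ _ _ _ x1 y1 t01.
  - by move=> *; rewrite linearD (dotDl dot).
  - by move=> *; rewrite (dotDr dot).
  - by move=> *; rewrite (linearZ_LR T) (dotZl dot).
  - by move=> *; rewrite (dotZr dot).
  apply: T0; exists (a *: x + b *: y) => //; rewrite zE !dot_real.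
  rewrite -!rmorphM -rmorphD.
  have -> : (1 - t) * q x + t * q y = 0 by rewrite /t; field; rewrite gt_eqF.
  by [].
have [z0 z0P] := H_neq0; have [_ [x [_ x1 _]]] := unit_factor z0P.
have homog s z : (forall y, rnorm y = 1 -> 0 <= s * q y) -> 0 <= s * q z.
  move=> sq; have [->|nz] := eqVneq z 0.
    by rewrite /q (dot0r dot) mulr0.
  have [a [y [a0 y1 ->]]] := unit_factor nz.
  have -> : q (a%:C *: y) = a ^+ 2 * q y.
    rewrite /q (linearZ_LR T) (dotZl dot) (dotZr dot) conj_real.
    by case: (dot (T y) y) => ? ? /=; ring.
  by rewrite mulrCA mulr_ge0 ?sqr_ge0 ?sq.
have [qx|qx] := ltP 0 (q x).
  exists 1; first by rewrite expr1n.
  move=> z; apply: homog => y y1; rewrite mul1r ltW//.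
  exact: no_sign_change x1 y1 qx.
exists (-1); first by rewrite sqrrN expr1n.
move=> z; apply: homog => y y1; rewrite mulN1r oppr_ge0 leNgt; apply/negP => qy.
by have := no_sign_change _ _ y1 x1 qy; rewrite ltNge qx.
Qed.

(** A semidefinite form [s * q] bounds the norm of its operator: its value at
    [z - (s / C) *: T z] is at most [s * q z - rnorm (T z) ^+ 2 / C] and is
    nonnegative. *)
Lemma selfadjoint_nu : ~ numrange dot T 0 -> 0 < nu dot T.
Proof.
move=> /selfadjoint_sign[s s1 sq].
apply: (@lt_le_trans _ _ (c ^+ 2 / C)); first by rewrite divr_gt0 ?exprn_gt0.
apply: nu_ge => // z z1; rewrite ler_pdivrMr//.
have cz : c ^+ 2 <= rnorm (T z) ^+ 2.
  by have := Tc z; rewrite z1 mulr1 => /(ler_sqr_nneg (ltW c0)).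
apply: le_trans cz _; rewrite dot_real sqmod_real sqrtr_sqr.
have s_norm : `|s| = 1.
  by apply/eqP; rewrite -(@eqrXn2 _ 2)// real_normK ?num_real// s1 expr1n.
have sqz : `|q z| = s * q z by rewrite -(ger0_norm (sq z)) normrM s_norm mul1r.
rewrite sqz; pose t := s / C.
have := sq (z - t%:C *: T z).
have -> : q (z - t%:C *: T z)
    = q z - 2 * t * rnorm (T z) ^+ 2 + t ^+ 2 * q (T z).
  rewrite /q (linearB T) (linearZ_LR T) !(dotDl dot, dotDr dot, dotNl dot, dotNr dot).
  rewrite !(dotZl dot, dotZr dot) conj_real (Tsa (T z) z) -!(Re_dotzz dotE).
  case: (dot (T z) z) (dot (T z) (T z)) (dot (T (T z)) (T z)) => ? ? [? ?] [? ?] /=.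
  ring.
have : s * q (T z) <= C * rnorm (T z) ^+ 2.
  rewrite -(ger0_norm (sq (T z))) normrM s_norm mul1r.
  apply: le_trans (Re_dot_le dotE _ _) _.
  by rewrite expr2 mulrA ler_wpM2r ?rnorm_ge0.
have tC : t * C = s by rewrite divfK// gt_eqF.
have st : s * t = C^-1 by rewrite /t mulrA -expr2 s1 mul1r.
move: (q (T z)) (q z) (rnorm (T z) ^+ 2) => Q p w Qw.
have -> : s * (p - 2 * t * w + t ^+ 2 * Q) = s * p - 2 * w / C + (s * Q) / C ^+ 2.
  have -> : t ^+ 2 = (C ^+ 2)^-1 by rewrite /t expr_div_n s1 mul1r.
  by rewrite -st; ring.
have : s * Q / C ^+ 2 <= w / C.
  rewrite ler_pdivrMr ?exprn_gt0//.
  by have -> : w / C * C ^+ 2 = C * w by [field; rewrite gt_eqF | ].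
have -> : 2 * w / C = 2 * (w / C) by rewrite mulrA.
by move=> wC wp; rewrite -ler_pdivrMr//; lra.
Qed.

End SelfAdjoint.

(** * Linear and strictly monotone convergence *)

Theorem proposition3p1 (R : realType) (H : completeNormedModType R[i])
  (dot : {dot H for Num.conj}) (dotE : forall z : H, dot z z = `|z| ^+ 2)
  (H_neq0 : exists z : H, z != 0)
  (B Binv : {linear H -> H})
  (B_bounded : bounded_near B (nbhs (0 : H)))
  (Binv_bounded : bounded_near Binv (nbhs (0 : H)))
  (BK : cancel B Binv) (BinvK : cancel Binv B) :
  let M_B := linear_reduction_factor B in
  let L1 := linear_gmres_convergence B in
  let L2 := 0 < nu dot B in
  let L3 := 0 < nu dot Binv in
  let M1 := strictly_monotone_gmres_convergence B in
  let M2 := ~ numrange dot B 0 in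
  let M3 := ~ numrange dot Binv 0 in
  [/\ [/\ M_B = inf [set opnorm (fun z => z - l *: B z) | l in [set: R[i]]],
          M_B = inf [set opnorm (fun z => z - l *: Binv z) | l in [set: R[i]]],
          M_B <= Num.sqrt (1 - nu dot B * nu dot Binv)
        & Num.sqrt (1 - nu dot B * nu dot Binv)
            <= Num.sqrt (1 - nu dot B ^+ 2 / opnorm B ^+ 2)],
      [<-> L1; L2; L3],
      [<-> M1; M2; M3]
    & finite_dimensional H \/ selfadjoint dot B ->
      [<-> L1; L2; L3; M1; M2; M3]].
Proof.
move=> M_B L1 L2 L3 M1 M2 M3.
have [C C0 BC] := bounded_rnorm B_bounded.
have [D D0 BinvD] := bounded_rnorm Binv_bounded.
have below (T U : {linear H -> H}) K : 0 < K -> cancel T U ->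
    (forall z, rnorm (U z) <= K * rnorm z) ->
    forall z, K^-1 * rnorm z <= rnorm (T z).
  by move=> K0 TU UK z; rewrite mulrC ler_pdivrMr// mulrC -{1}(TU z).
have Bc := below B Binv D D0 BK BinvD; have D0' : 0 < D^-1 by rewrite invr_gt0.
have Binvc := below Binv B C C0 BinvK BC; have C0' : 0 < C^-1 by rewrite invr_gt0.
have L12 : L1 -> L2 by exact: (linear_gmres_nu dotE H_neq0 D0' Bc).
have L23 : L2 -> L3 by exact: (nu_inv_gt0 H_neq0 BK BinvK BC D0' Bc).
have L32 : L3 -> L2 by exact: (nu_inv_gt0 H_neq0 BinvK BK BinvD C0' Binvc).
have L21 : L2 -> L1 by exact: (nu_linear_gmres dotE H_neq0 BK BinvK BC D0' Bc).
have M12 : M1 -> M2 by exact: (strictly_monotone_numrange dotE).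
have M23 : M2 -> M3 by apply: contra_not; exact: numrange0_inv BinvK.
have M32 : M3 -> M2 by apply: contra_not; exact: numrange0_inv BK.
have M21 : M2 -> M1 by exact: (numrange_strictly_monotone dotE).
split.
- split.
  + exact: (reduction_factorE dotE H_neq0 C0 BC D0' Bc).
  + rewrite -(reduction_factorE dotE H_neq0 D0 BinvD C0' Binvc) /M_B.
    apply/eqP; rewrite eq_le.
    rewrite (reduction_factor_inv_le dotE BinvK).
    by rewrite (reduction_factor_inv_le dotE BK).
  + exact: (reduction_factor_nu dotE H_neq0 BK D0' Bc).
  + rewrite ler_wsqrtr// lerD2l lerN2 expr2 -mulrA ler_wpM2l//.
      exact: nu_ge0.
    exact: (nu_inv_ge _ H_neq0 BK BinvK BC D0' Bc).
- by tfae => // /L32/L21.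
- by tfae => // /M32/M21.
- move=> finsa; have M2L2 : M2 -> L2.
    case: finsa => [fin|sa].
      exact: (finite_dimensional_nu dotE C0 BC H_neq0 fin).
    exact: (selfadjoint_nu dotE H_neq0 C0 BC D0' Bc sa).
  tfae => //.
  + by move=> /nu_gt0_numrange/M32/M21.
  + by move=> /M32/M2L2/L21.
Qed.
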